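(* Consider the maximum coverage problem in the following massively parallel computation (MPC) setting. There are $m$ sets $S_1,\dots,S_m\subseteq[n]=\{1,\dots,n\}$ with $m\le n$, and an integer $k$ with $k=\Omega(m)$. There are $m$ machines, each with $\tilde O(n)$ memory, and machine $j$ initially holds $S_j$. Computation proceeds in synchronous rounds; in each round every machine may send messages to other machines, subject to no machine receiving more than $\tilde O(n)$ total message size. Let $\mathrm{Opt}$ be the maximum, over all choices of $k$ of the sets, of $|\bigcup_{j\in J}S_j|$ with $|J|=k$. Then for every $\epsilon\in(0,1)$ there is an algorithm that, with high probability (i.e. with probability at least $1-1/\mathrm{poly}(m)$), finds $k$ sets whose union contains at least $(1-1/e-\epsilon)\mathrm{Opt}$ elements, using $O\big(\epsilon^{-3}\cdot\log m\cdot(\log(1/\epsilon)+\log m)\big)$ rounds.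
   Context: $\tilde O(\cdot)$ hides polylogarithmic factors. ''With high probability'' means with probability $1-1/\mathrm{poly}(m)$. *)

(* Defs.v *)
From mathcomp Require Import all_boot all_order all_algebra.
From mathcomp Require Import reals sequences exp.

Set Implicit Arguments.
Unset Strict Implicit.
Unset Printing Implicit Defensive.

Import Order.TTheory GRing.Theory Num.Theory.

Local Open Scope ring_scope.

Definition bits := seq bool.

(* A randomized MPC algorithm on m machines.  Local computation is unrestricted,
   as usual in this model: it is an arbitrary function of the machine's index,
   the round number, the machine's own memory, its own fresh random bits for
   that round, and (for [update]) the messages it received in that round.
   [send t j s c i] is the message from j to i; the empty string means that
   nothing is sent.  The output is distributed: after the last round each
   machine j decides from its own memory whether S_j is selected. *)
Record mpc (m : nat) := MPC {
  rounds : nat;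
  ncoins : nat;
  send : nat -> 'I_m -> bits -> ncoins.-tuple bool -> 'I_m -> bits;
  update : nat -> 'I_m -> bits -> ncoins.-tuple bool -> ('I_m -> bits) -> bits;
  select : 'I_m -> bits -> bool
}.

Arguments send {m} A t j s c i : rename.
Arguments update {m} A t j s c q : rename.

Section Execution.
Variables (m n : nat) (A : mpc m) (S : 'I_m -> {set 'I_n}).

(* Private coins of all the machines in all the rounds. *)
Definition coins : finType :=
  (rounds A).-tuple {ffun 'I_m -> (ncoins A).-tuple bool}.

(* The default value of [nth] is irrelevant: only rounds t < rounds A matter. *)
Definition coin (w : coins) (t : nat) (j : 'I_m) : (ncoins A).-tuple bool :=
  nth [ffun => nseq_tuple (ncoins A) false] w t j.

(* Machine j initially holds S_j, as an n-bit indicator string. *)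
Definition input (j : 'I_m) : bits := [seq i \in S j | i <- enum 'I_n].

Definition inbox_of (w : coins) (t : nat) (mem : 'I_m -> bits) (j i : 'I_m) :
  bits := send A t i (mem i) (coin w t i) j.

(* Memory contents of the machines after t rounds. *)
Fixpoint memory (w : coins) (t : nat) : 'I_m -> bits :=
  if t is t'.+1 then
    fun j => update A t' j (memory w t' j) (coin w t' j)
               (inbox_of w t' (memory w t') j)
  else input.

(* [inbox w t j i] is the message that j receives from i in round t. *)
Definition inbox (w : coins) (t : nat) : 'I_m -> 'I_m -> bits :=
  inbox_of w t (memory w t).

Definition output (w : coins) : {set 'I_m} :=
  [set j | select A j (memory w (rounds A) j)].

(* For every outcome of the coins, no machine ever stores or receives (in one
   round, over all senders) more than B bits.  The random bits that a machine
   uses within a round are subject to the same limit. *)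
Definition within_space (R : realType) (B : R) : Prop :=
  [/\ (ncoins A)%:R <= B,
      forall (w : coins) (t : nat) (j : 'I_m),
        (t <= rounds A)%N -> (size (memory w t j))%:R <= B
    & forall (w : coins) (t : nat) (j : 'I_m),
        (t < rounds A)%N -> (\sum_(i < m) size (inbox w t j i))%N%:R <= B].

Definition prob (R : realType) (E : pred coins) : R :=
  #|E|%:R / #|coins|%:R.

End Execution.

Definition coverage (m n : nat) (S : 'I_m -> {set 'I_n}) (J : {set 'I_m}) : nat :=
  #|\bigcup_(j in J) S j|.

Definition opt (m n : nat) (S : 'I_m -> {set 'I_n}) (k : nat) : nat :=
  \max_(J : {set 'I_m} | #|J| == k) coverage S J.

Definition good_cover (R : realType) (m n : nat) (S : 'I_m -> {set 'I_n})
    (k : nat) (eps : R) (J : {set 'I_m}) : bool :=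
  (#|J| == k) &&
  ((1 - (expR 1)^-1 - eps) * (opt S k)%:R <= (coverage S J)%:R).

(* The bound a * n * polylog(n) hidden by soft-O notation; since m <= n this also
   absorbs factors polylogarithmic in m.  The "1 +" only serves n = 1, 2. *)
Definition soft_linear (R : realType) (a : R) (p n : nat) : R :=
  a * n%:R * (1 + ln n%:R) ^+ p.

(* Main.v *)
(* Let E be about 1/eps.  Continuous greedy is run on the concave function
   F(x) = \sum_e (1 - exp (- y_e)), with y_e the sum of x_j over the sets
   containing e: T steps of length 1/T, each in the direction of the k sets of
   largest gain, bring F to (1 - 1/e) Opt up to second-order errors.  Starting
   from x_j = D/T for all j damps the weight exp (- y_e) of an element of degree
   d by exp (- D d / T), so the second-order errors sum to O(T/D^2) times the
   number of covered elements, which is O(Opt) because k = Omega(m); the starting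
   point costs only a factor 1 + O(1/E) in the budget when D = Theta(T/E), and
   T = Theta(E^3) suffices.  Drawing k sets independently with probabilities
   proportional to x covers at least (1 - O(1/E)) F elements on average, so by
   Markov's inequality a draw is good with probability at least 1/(2E), and
   O(E d log m) draws are enough.
   One step needs O(1) rounds: the elements are split into m blocks, and machine
   i holds the restriction of all the sets to block i, so that every gain is a
   sum of m numbers, one per machine.  When E > m, numbers of log E bits need not
   fit in the memory, but the m rounds of the plain greedy algorithm are
   affordable. *)
Require Import Defs.
From mathcomp Require Import all_boot all_order all_algebra.
From mathcomp Require Import reals sequences exp.
From mathcomp Require Import ring lra zify.

Set Implicit Arguments.
Unset Strict Implicit.
Unset Printing Implicit Defensive.

Import Order.TTheory GRing.Theory Num.Theory.

Local Open Scope ring_scope.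

(** * Protocols with a shared state *)

Section Code.
Variable T : finType.

Definition width := up_log 2 #|T|.

Lemma leq_card_width : (#|T| <= #|{: width.-tuple bool}|)%N.
Proof. by rewrite card_tuple card_bool up_logP. Qed.

(** All codewords of a type have the same length, so the space used by a protocol depends only on
    the cardinalities of the types it stores and sends. *)
Definition code (x : T) : bits :=
  tval (enum_val (widen_ord leq_card_width (enum_rank x))).

Definition decode (x0 : T) (s : bits) : T := odflt x0 [pick x | code x == s].

Lemma size_code x : size (code x) = width.
Proof. by rewrite size_tuple. Qed.

Lemma code_inj : injective code.
Proof.
move=> x y /val_inj /enum_val_inj /(congr1 val) /= h.
exact/enum_rank_inj/val_inj.
Qed.

Lemma codeK x0 : cancel code (decode x0).
Proof.
move=> x; rewrite /decode; case: pickP => [y /eqP /code_inj //|/(_ x)].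
by rewrite eqxx.
Qed.

End Code.

(* A computation whose state after each step is known to all the machines: the
   machines contribute vectors that depend on this state, on the elements of
   their block and on their coins, and the next state depends only on the
   previous one and on the sum of the contributions. *)
Record protocol (m n : nat) := Protocol {
  shared : finType;
  start : shared;
  maxsum : nat;
  seedlen : nat;
  summand : nat -> 'I_m -> shared -> {ffun 'I_m -> {set 'I_n}} ->
            seedlen.-tuple bool -> 'I_m -> nat;
  step : nat -> shared -> {ffun 'I_m -> nat} -> shared;
  result : shared -> {set 'I_m}
}.

Arguments summand {m n} P t i s V c j : rename.
Arguments step {m n} P t s sigma : rename.
Arguments start {m n} P : rename.

Section Protocol.
Variables (m n : nat).
Implicit Types (S : 'I_m -> {set 'I_n}) (i j : 'I_m).

(** Splitting by residues modulo [m] lets the quotient by [m] serve as the position of an element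
    inside its block. *)
Definition block i : {set 'I_n} :=
  [set e | nat_of_ord e %% m == i]%N.

Definition view S i : {ffun 'I_m -> {set 'I_n}} :=
  [ffun j => S j :&: block i].

Lemma sum_block (V : nmodType) (F : 'I_n -> V) : (0 < m)%N ->
  \sum_i \sum_(e in block i) F e = \sum_e F e.
Proof.
move=> m_gt0; rewrite (exchange_big_dep xpredT) //=; apply: eq_bigr => e _.
rewrite (bigD1 (Ordinal (ltn_pmod e m_gt0))) ?inE //= big1 ?addr0 // => i.
by rewrite inE => /andP[/eqP h /eqP []]; apply: val_inj; rewrite /= h.
Qed.

Lemma sum_card_block (A : {set 'I_n}) : (0 < m)%N ->
  (\sum_i #|A :&: block i| = #|A|)%N.
Proof.
move=> m_gt0; rewrite -[RHS]sum1_card [RHS]big_mkcond /=.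
rewrite -(@sum_block nat (fun e => nat_of_bool (e \in A))) //.
apply: eq_bigr => i _; rewrite -sum1_card big_mkcond [RHS]big_mkcond /=.
by apply: eq_bigr => e _; rewrite inE; case: (e \in A); case: (e \in block i).
Qed.

Lemma sum_coverage_view S (J : {set 'I_m}) : (0 < m)%N ->
  (\sum_i coverage (view S i) J = coverage S J)%N.
Proof.
move=> m_gt0; rewrite /coverage -sum_card_block //; apply: eq_bigr => i _.
by congr #|pred_of_set _|; rewrite big_distrl /=; apply: eq_bigr => j _; rewrite ffunE.
Qed.

Variable P : protocol m n.

Section Run.
Variables (S : 'I_m -> {set 'I_n}) (z : nat -> 'I_m -> (seedlen P).-tuple bool).

Definition pooled t (s : shared P) j : nat :=
  \sum_i summand P t i s (view S i) (z t i) j.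

Fixpoint run (t : nat) : shared P :=
  if t is t'.+1 then step P t' (run t') [ffun j => pooled t' (run t') j]
  else start P.

End Run.

(** This is what keeps [inord] from altering a contribution or a sum. It is asked of every state
    [s], reachable or not, which spares an invariant on states. *)
Definition bounded_sums := forall S z t s j, (pooled S z t s j <= maxsum P)%N.

Definition blocksize := (n %/ m).+1.

Definition slice i (A : {set 'I_n}) : {set 'I_blocksize} :=
  [set l | [exists e in A, nat_of_ord e == nat_of_ord l * m + i]%N].

Definition unslice i (V : {set 'I_m * 'I_blocksize}) :
  {ffun 'I_m -> {set 'I_n}} :=
  [ffun j => [set e in block i | (j, inord (e %/ m)) \in V]].

Lemma slices_view S i :
  unslice i [set jl | jl.2 \in slice i (S jl.1)] = view S i.
Proof.
apply/ffunP => j; rewrite !ffunE; apply/setP => e; rewrite !inE /=.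
rewrite andbC; case: eqP => [e_i|]; rewrite ?andbF // !andbT.
have e_lt : (e %/ m < blocksize)%N by rewrite ltnS leq_div2r // ltnW.
rewrite inordK //; apply/existsP/idP => [[e' /andP[e'S /eqP e'E]]|eS].
  by suff -> : e = e' by []; apply: val_inj; rewrite /= e'E -e_i -divn_eq.
by exists e; rewrite eS -e_i -divn_eq /=.
Qed.

(** The last component is a register that holds the sum formed in an odd round until the next round
    broadcasts it. *)
Definition machine_state : finType :=
  ({set 'I_m * 'I_blocksize} * shared P * 'I_(maxsum P).+1)%type.

Definition machine_state0 : machine_state := (set0, start P, ord0).

(* Round 0 hands every machine its block of elements of all the sets.  Then one
   step of the protocol takes an odd round, in which machine j adds up the
   coordinate j of the contributions, and an even one, in which the sums are
   broadcast. *)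
Definition protocol_send (t : nat) i (mem : bits)
    (c : (seedlen P).-tuple bool) j : bits :=
  if t == 0%N then code (slice j [set e | nth false mem (nat_of_ord e)])
  else let: (V, s, x) := decode machine_state0 mem in
    if odd t then
      code (inord (summand P t./2 i s (unslice i V) c j) : 'I_(maxsum P).+1)
    else code x.

Definition protocol_update (t : nat) i (mem : bits)
    (c : (seedlen P).-tuple bool) (q : 'I_m -> bits) : bits :=
  if t == 0%N then
    code (([set jl | jl.2 \in decode (set0 : {set 'I_blocksize}) (q jl.1)],
           start P, ord0) : machine_state)
  else let: (V, s, x) := decode machine_state0 mem in
    if odd t then
      code ((V, s, inord (\sum_j (decode (ord0 : 'I_(maxsum P).+1) (q j) : nat)))
            : machine_state)
    else
      code ((V, step P t./2.-1 s
              [ffun j => nat_of_ord (decode (ord0 : 'I_(maxsum P).+1) (q j))],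
             ord0) : machine_state).

Definition protocol_select i (mem : bits) : bool :=
  let: (V, s, x) := decode machine_state0 mem in i \in result s.

Definition compile (N : nat) : mpc m :=
  MPC (N.*2.+1) protocol_send protocol_update protocol_select.

Definition seed N (w : coins (compile N)) (t : nat) i := coin w t.*2.+1 i.

(** After the initial exchange each step takes two rounds, so [t] steps are complete after [t.*2.+1]
    rounds; the contributions of step [t] use the coins of round [t.*2.+1]. *)
Lemma compile_memory N S w t i : bounded_sums ->
  memory S w t.*2.+1 i =
  code (([set jl | jl.2 \in slice i (S jl.1)], run S (@seed N w) t, ord0)
        : machine_state).
Proof.
move=> bndP; elim: t i => [|t IHt] i.
  rewrite /= /protocol_update /=; congr code; congr (_, _, _); apply/setP => -[j l].
  rewrite inE [RHS]inE /inbox_of /= /protocol_send /= codeK.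
  congr (_ \in slice i _); apply/setP => e; rewrite inE /input (nth_map e) -?cardE ?card_ord //.
  by rewrite nth_ord_enum.
have memS u j : memory S w u.+1 j =
  protocol_update u j (memory S w u j) (coin w u j)
    (fun j' => protocol_send u j' (memory S w u j') (coin w u j') j) by [].
(* Halfway through a step, machine [j] holds the pooled coordinate [j] in its register. Each single
   contribution is at most the pooled sum, so it survives [inord] too. *)
have memE j : memory S w t.*2.+2 j =
    code (([set jl | jl.2 \in slice j (S jl.1)], run S (@seed N w) t,
           inord (pooled S (@seed N w) t (run S (@seed N w) t) j))
          : machine_state).
  rewrite memS IHt /protocol_update [_ == _]/= codeK [odd _]/= odd_double.
  congr code; congr (_, _, _); congr inord; apply: eq_bigr => j' _.
  rewrite IHt /protocol_send [_ == _]/= codeK [odd _]/= odd_double [(~~ _)]/=.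
  rewrite codeK slices_view [_./2]/= uphalf_double inordK // ltnS.
  apply: leq_trans (bndP S (@seed N w) t (run S (@seed N w) t) j).
  by rewrite /pooled (bigD1 j') //= leq_addr.
rewrite doubleS memS memE /protocol_update [_ == _]/= codeK [odd _]/= negbK.
rewrite odd_double [_./2.-1]/= doubleK.
congr code; congr (_, _, _); congr step.
apply/ffunP => j; rewrite !ffunE memE /protocol_send [_ == _]/= codeK [odd _]/=.
by rewrite negbK odd_double codeK inordK // ltnS bndP.
Qed.

Lemma compile_output N S w : bounded_sums ->
  output S w = result (run S (@seed N w) N).
Proof.
move=> bndP; apply/setP => i; rewrite inE [rounds _]/= compile_memory //.
by rewrite /= /protocol_select codeK.
Qed.

Lemma compile_within_space (R : realType) N S (B : R) :
  (seedlen P)%:R <= B -> n%:R <= B -> (width machine_state)%:R <= B ->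
  (m * blocksize)%N%:R <= B -> (m * width 'I_(maxsum P).+1)%N%:R <= B ->
  within_space (compile N) S B.
Proof.
move=> hL hn hM hb hQ; split => // w t.
  move=> j _; case: t => [|t].
    by rewrite /= /input size_map -cardE card_ord.
  rewrite /= /protocol_update; case: ifP => _; first by rewrite size_code.
  by case: (decode _ _) => [[V s] x]; case: ifP => _; rewrite size_code.
move=> j _; case: t => [|t].
  rewrite (eq_bigr (fun=> blocksize)) ?sum_nat_const ?card_ord // => i _.
  rewrite /inbox /inbox_of /= /protocol_send /= size_code /width.
  by rewrite -cardsT -powersetT card_powerset cardsT card_ord up_expnK.
rewrite (eq_bigr (fun=> width 'I_(maxsum P).+1)) ?sum_nat_const ?card_ord // => i _.
rewrite /inbox /inbox_of [send _ _ _ _ _ _]/= /protocol_send /=.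
by case: (decode _ _) => [[V s] x]; case: ifP => _; rewrite size_code.
Qed.

End Protocol.

(** * Choosing k sets *)

Section Subsets.
Variables (m k : nat).
Hypothesis le_km : (k <= m)%N.
Implicit Types (f : 'I_m -> nat) (J K : {set 'I_m}).

Lemma card_ltn_ord : #|[set j : 'I_m | (j < k)%N]| = k.
Proof.
rewrite -sum1_card (eq_bigl (fun j : 'I_m => (j < k)%N)) => [|j]; last by rewrite inE.
by rewrite (big_ord_narrow le_km) /= sum1_card card_ord.
Qed.

Definition topset f : {set 'I_m} :=
  arg_max [set j : 'I_m | (j < k)%N] (fun K => #|K| == k)
    (fun K => \sum_(j in K) f j)%N.

Lemma card_topset f : #|topset f| = k.
Proof.
by rewrite /topset; case: arg_maxnP => [|K /eqP //]; rewrite card_ltn_ord.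
Qed.

Lemma topset_max f J : #|J| = k ->
  (\sum_(j in J) f j <= \sum_(j in topset f) f j)%N.
Proof.
move=> cJ; rewrite /topset; case: arg_maxnP => [|K _ maxK].
  by rewrite card_ltn_ord.
by apply: maxK; rewrite cJ.
Qed.

(** By exchange, every member of the top set has a value at least that of every non-member; summing
    over such pairs compares the average inside with the average outside. *)
Lemma topset_average f :
  (k * \sum_j f j <= m * \sum_(j in topset f) f j)%N.
Proof.
set K := topset f; have cK : #|K| = k := card_topset f.
have exch i j : i \in K -> j \notin K -> (f j <= f i)%N.
  move=> iK jK; have cKij : #|j |: (K :\ i)| = k.
    by rewrite cardsU1 !inE (negPf jK) andbF /= -[in RHS]cK (cardsD1 i K) iK.
  have := topset_max f cKij; rewrite -/K (big_setD1 i iK) /=.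
  rewrite big_setU1 ?leq_add2r //.
  by rewrite !inE (negPf jK) andbF.
have cKC : #|~: K| = (m - k)%N by rewrite cardsCs setCK cK card_ord.
have le_out : (k * \sum_(j in ~: K) f j <= (m - k) * \sum_(j in K) f j)%N.
  have -> : (k * \sum_(j in ~: K) f j = \sum_(j in ~: K) \sum_(i in K) f j)%N.
    by rewrite big_distrr /=; apply: eq_bigr => j _; rewrite sum_nat_const cK.
  rewrite -cKC -sum_nat_const; apply: leq_sum => j; rewrite inE => jK.
  by apply: leq_sum => i /exch; apply.
rewrite [X in (_ * X)%N](bigID (mem K)) /= mulnDr.
have -> x : (m * x = k * x + (m - k) * x)%N by rewrite -mulnDl subnKC.
rewrite leq_add2l.
by rewrite (eq_bigl (mem (~: K))) // => j; rewrite /= inE.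
Qed.

(** The default, the first [k] indices, is taken when [J] has more than [k] elements, so that the
    result has [k] elements in every case. *)
Definition pad J : {set 'I_m} :=
  odflt [set j : 'I_m | (j < k)%N] [pick K : {set 'I_m} | (J \subset K) && (#|K| == k)].

Lemma card_pad J : #|pad J| = k.
Proof.
by rewrite /pad; case: pickP => [K /andP[_ /eqP]//|_] /=; rewrite card_ltn_ord.
Qed.

Lemma sub_pad J : (#|J| <= k)%N -> J \subset pad J.
Proof.
move=> cJ; suff [K JK cK] : exists2 K : {set 'I_m}, J \subset K & #|K| = k.
  by rewrite /pad; case: pickP => [K' /andP[]//|/(_ K)]; rewrite JK cK eqxx.
have : (k - #|J| <= #|~: J|)%N by rewrite (cardsCs (~: J)) setCK card_ord leq_sub2r.
case/(@card_geqP _ (~: J) _) => s [us ss sJ].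
exists (J :|: [set x in s]); first exact: subsetUl.
rewrite cardsU (_ : J :&: _ = set0) ?cards0 ?subn0.
  by rewrite cardsE (card_uniqP us) ss subnKC.
apply/setP => x; rewrite !inE; apply/negP => /andP[xJ /sJ].
by rewrite inE xJ.
Qed.

End Subsets.

Section Optimum.
Variables (m n k : nat) (S : 'I_m -> {set 'I_n}).
Hypothesis le_km : (k <= m)%N.

Lemma coverage_le_opt (J : {set _}) : #|J| = k -> (coverage S J <= opt S k)%N.
Proof. by move=> cJ; apply: leq_bigmax_cond; rewrite cJ. Qed.

Lemma opt_witness : exists2 J : {set _}, #|J| = k & coverage S J = opt S k.
Proof.
have [|J /eqP cJ maxJ] := @eq_bigmax_cond _ [pred J : {set 'I_m} | #|J| == k] (coverage S).
  by apply/card_gt0P; exists [set j : 'I_m | (j < k)%N]; rewrite inE card_ltn_ord.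
by exists J => //; rewrite -maxJ.
Qed.

Lemma coverage_mono (J K : {set 'I_m}) : J \subset K -> (coverage S J <= coverage S K)%N.
Proof.
move=> JK; apply/subset_leq_card/bigcupsP => j jJ.
exact/bigcup_sup/(subsetP JK).
Qed.

(* Assign every covered element to one of the sets containing it, and take the
   k sets with the most assigned elements. *)
Lemma opt_ge_fraction :
  (k * #|\bigcup_j S j| <= m * opt S k)%N.
Proof.
pose own e := [pick j | e \in S j].
pose f j := (\sum_e (own e == Some j))%N.
have sum_f (K : {set 'I_m}) :
    (\sum_(j in K) f j = \sum_e if own e is Some j then j \in K else false)%N.
  rewrite exchange_big /=; apply: eq_bigr => e _.
  case: (own e) => [j0|]; last by rewrite big1.
  rewrite (eq_bigr (fun j => nat_of_bool (j == j0))) => [|j _]; last by rewrite eq_sym.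
  case: (boolP (j0 \in K)) => j0K.
    by rewrite (bigD1 j0) //= eqxx big1 // => j /andP[_ /negPf ->].
  by rewrite big1 // => j jK; case: eqP j0K => // <-; rewrite jK.
have fK (K : {set 'I_m}) : (\sum_(j in K) f j <= coverage S K)%N.
  rewrite sum_f /coverage -sum1_card [X in (_ <= X)%N]big_mkcond /=.
  apply: leq_sum => e _; rewrite /own; case: pickP => [j ej|//].
  case: (boolP (j \in K)) => // jK.
  by rewrite (_ : e \in _) //; apply/bigcupP; exists j.
have fT : (#|\bigcup_j S j| <= \sum_j f j)%N.
  have -> : (\sum_j f j = \sum_(j in [set: 'I_m]) f j)%N.
    by apply: eq_bigl => j; rewrite inE.
  rewrite sum_f -sum1_card big_mkcond /=; apply: leq_sum => e _.
  rewrite /own; case: pickP => [j ej|noj]; first by rewrite inE; case: ifP.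
  by case: bigcupP => // -[j _]; rewrite noj.
apply: leq_trans (leq_trans (topset_average le_km f) _).
  by rewrite leq_mul2l fT orbT.
rewrite leq_mul2l; apply/orP; right; apply: leq_trans (fK _) _.
by apply: coverage_le_opt; apply: card_topset.
Qed.

End Optimum.

(** * Greedy and fractional solutions *)

Section Recursion.
Variable R : realType.

(** Here [phi] is a shortfall from the optimum. Unrolling gives the factor (1 - 1/T)^T <= 1/e, and
    the errors add up to at most [T * eta] because they are never amplified. *)
Lemma contraction_bound (T : nat) (phi : nat -> R) (eta B : R) :
  (0 < T)%N -> 0 <= eta -> 0 <= B -> phi 0%N <= B ->
  (forall t, (t < T)%N -> phi t.+1 <= (1 - T%:R^-1) * phi t + eta) ->
  phi T <= (expR 1)^-1 * B + T%:R * eta.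
Proof.
move=> T_gt0 eta0 B0 phi0 step.
have Tr : 0 < T%:R :> R by rewrite ltr0n.
set q : R := 1 - T%:R^-1.
have q0 : 0 <= q by rewrite subr_ge0 invf_le1 // ler1n.
have q1 : q <= 1 by rewrite lerBlDr lerDl invr_ge0 ltW.
have main t : (t <= T)%N -> phi t <= q ^+ t * B + t%:R * eta.
  elim: t => [_|t IHt lt_tT]; first by rewrite expr0 mul1r mul0r addr0.
  apply: (le_trans (step _ lt_tT)); rewrite -/q exprS -mulrA -natr1.
  have := ler_wpM2l q0 (IHt (ltnW lt_tT)).
  have : q * (t%:R * eta) <= t%:R * eta by rewrite ler_piMl // mulr_ge0.
  by rewrite mulrDr mulrDl mul1r; lra.
apply: (le_trans (main T (leqnn T))); rewrite lerD2r ler_wpM2r //.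
have -> : (expR 1)^-1 = expR (- T%:R^-1) ^+ T :> R.
  by rewrite -expRM_natr mulNr mulVf ?expRN // gt_eqF.
rewrite lerXn2r ?nnegrE ?expR_ge0 //.
exact: (expR_ge1Dx (- T%:R^-1)).
Qed.

Lemma expRN_quadratic (z : R) : 0 <= z -> expR (- z) <= 1 - z + z ^+ 2.
Proof.
move=> z0; have e1 := expR_ge1Dx z; rewrite expRN.
have z1 : 0 < 1 + z by lra.
apply: (@le_trans _ _ (1 + z)^-1); first by rewrite lef_pV2 ?posrE ?expR_gt0.
rewrite -[leLHS]mul1r ler_pdivrMr //.
(* (1 + z)(1 - z + z^2) = 1 + z^3. *)
have : 0 <= z ^+ 3 by rewrite exprn_ge0.
by nra.
Qed.

Lemma sqr_expRN_le (u : R) : 0 <= u -> u ^+ 2 * expR (- u) <= 4.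
Proof.
move=> u0; rewrite expRN -ler_pdivlMr ?invr_gt0 ?expR_gt0 // invrK.
have -> : expR u = expR (u / 2) ^+ 2 by rewrite -expRM_natr divfK ?pnatr_eq0.
have := expR_ge1Dx (u / 2) => h.
have : u / 2 <= expR (u / 2) by lra.
have : 0 <= u / 2 by rewrite divr_ge0.
by nra.
Qed.

End Recursion.

Section Greedy.
Variables (m n k : nat) (S : 'I_m -> {set 'I_n}).
Hypothesis le_km : (k <= m)%N.

Lemma opt_le_marginals (J : {set 'I_m}) : exists2 K : {set 'I_m}, #|K| = k &
  (opt S k <= coverage S J + \sum_(j in K) #|S j :\: \bigcup_(i in J) S i|)%N.
Proof.
have [K cK <-] := opt_witness S le_km; exists K => //.
set U := \bigcup_(i in J) S i.
have : \bigcup_(j in K) S j \subset U :|: \bigcup_(j in K) (S j :\: U).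
  apply/bigcupsP => j jK; apply/subsetP => e ej; rewrite inE.
  by case: (boolP (e \in U)) => //= eU; apply/bigcupP; exists j; rewrite // inE eU.
move/subset_leq_card/leq_trans; apply; apply: leq_trans (leq_card_setU _ _) _.
rewrite leq_add2l; elim/big_rec2: _ => [|j x A _ le_Ax]; first by rewrite cards0.
by apply: leq_trans (leq_card_setU _ _) _; rewrite leq_add2l.
Qed.

Lemma coverageU1 (J : {set 'I_m}) j :
  coverage S (j |: J) = (coverage S J + #|S j :\: \bigcup_(i in J) S i|)%N.
Proof.
rewrite /coverage bigcup_setU big_set1 setUC; set U := \bigcup_(i in J) S i.
rewrite cardsU cardsD addnBA ?subset_leq_card ?subsetIl //.
by rewrite setIC.
Qed.

(** The [k] marginals of an optimal solution add up to at least the shortfall, so the best marginal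
    is at least a 1/k fraction of it: the shortfall contracts by 1 - 1/k. *)
Lemma greedy_bound (R : realType) (J : nat -> {set 'I_m}) :
  (0 < k)%N ->
  (forall t, exists2 j, J t.+1 = j |: J t &
     forall i, #|S i :\: \bigcup_(i in J t) S i| <=
               #|S j :\: \bigcup_(i in J t) S i|)%N ->
  (1 - (expR 1)^-1) * (opt S k)%:R <= (coverage S (J k))%:R :> R.
Proof.
move=> k_gt0 JS; have kr : 0 < k%:R :> R by rewrite ltr0n.
have := @contraction_bound R k
  (fun t => (opt S k)%:R - (coverage S (J t))%:R : R) 0 (opt S k)%:R k_gt0 (lexx 0).
rewrite mulr0 addr0 => main.
have -> : (1 - (expR 1)^-1) * (opt S k)%:R =
  (opt S k)%:R - (expR 1)^-1 * (opt S k)%:R :> R by rewrite mulrBl mul1r.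
rewrite lerBlDr -lerBlDl; apply: main; rewrite ?ler0n ?gerBl //.
move=> t _; have [j -> maxj] := JS t; rewrite coverageU1 natrD addr0.
move: maxj; set g := #|_| => maxj; have [K cK le_opt] := opt_le_marginals (J t).
have le_g : (opt S k <= coverage S (J t) + k * g)%N.
  apply: leq_trans le_opt _; rewrite leq_add2l -[X in (X * _)%N]cK -sum_nat_const.
  by apply: leq_sum => i _; apply: maxj.
move: le_g; rewrite -(ler_nat R) natrD natrM => le_g.
rewrite mulrBl mul1r opprD addrA lerD2l lerN2 mulrC ler_pdivrMr //.
by lra.
Qed.

End Greedy.

Section Fractional.
Variables (R : realType) (m n : nat) (D T : nat).
Hypotheses (D_gt0 : (0 < D)%N) (T_gt0 : (0 < T)%N).
Implicit Types (V S : 'I_m -> {set 'I_n}) (X : 'I_m -> nat) (e : 'I_n).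

(** This is [T] times y_e: fractional values are kept as integer numerators over [T], and [D] is the
    common starting value. *)
Definition load V X e : nat := \sum_(j | e \in V j) (X j + D).

Definition weight V X e : R := expR (- ((load V X e)%:R / T%:R)).

Definition smooth_coverage V X : R := \sum_e (1 - weight V X e).

Lemma weight_ge0 V X e : 0 <= weight V X e. Proof. exact: expR_ge0. Qed.

Lemma weight_le1 V X e : weight V X e <= 1.
Proof. by rewrite expR_le1 oppr_le0 divr_ge0. Qed.

(* The summand D of the load makes the weight of an element decay with its
   degree d, so that the second-order term (d / T)^2 of a step is always paid
   for. *)
Lemma weight_step V X X' (K : {set 'I_m}) e :
  (forall j, X' j = X j + (j \in K))%N ->
  weight V X' e <= weight V X e
    - weight V X e * (#|[set j in K | e \in V j]|%:R / T%:R)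
    + (if e \in \bigcup_j V j then 4 / D%:R ^+ 2 else 0).
Proof.
move=> X'E; set v := #|_|; set d := #|[set j | e \in V j]|.
have Tr : 0 < T%:R :> R by rewrite ltr0n.
have Dr : 0 < D%:R :> R by rewrite ltr0n.
have loadE : load V X' e = (load V X e + v)%N.
  rewrite /load (eq_bigr (fun j => (X j + D) + (j \in K))%N); last first.
    by move=> j _; rewrite X'E addnAC.
  rewrite big_split /=; congr addn.
  rewrite /v -sum1_card big_mkcond [RHS]big_mkcond /=; apply: eq_bigr => j _.
  by rewrite inE andbC; case: ifP => // _; case: (j \in K).
have vd : (v <= d)%N by apply: subset_leq_card; apply/subsetP => j; rewrite !inE => /andP[].
have dload : (D * d <= load V X e)%N.
  rewrite mulnC /d -sum_nat_const (eq_bigl (fun j => e \in V j)) => [|j].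
    by apply: leq_sum => j _; rewrite leq_addl.
  by rewrite inE.
have e_uncovered : e \notin \bigcup_j V j -> v = 0%N.
  move=> eV; apply/eqP; rewrite cards_eq0; apply/eqP/setP => j; rewrite !inE.
  by apply/andP => -[_ ej]; case/bigcupP: eV; exists j.
rewrite {1}/weight loadE natrD mulrDl opprD expRD -/(weight V X e).
set z := v%:R / T%:R; have z0 : 0 <= z by rewrite divr_ge0.
set w := weight V X e; have w0 : 0 <= w := weight_ge0 V X e.
apply: (@le_trans _ _ (w * (1 - z + z ^+ 2))).
  by rewrite ler_wpM2l // expRN_quadratic.
have -> : w * (1 - z + z ^+ 2) = w - w * z + w * z ^+ 2 by ring.
rewrite lerD2l; case: ifPn => [_|/e_uncovered v0]; last first.
  by rewrite /z v0 mul0r expr0n mulr0.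
(* The load is at least [D * d] and [z] is at most [u / D], so [w * z ^+ 2] is at most u^2 exp(-u) /
   D^2, and [sqr_expRN_le] bounds the numerator by 4. *)
set u : R := D%:R * d%:R / T%:R; have u0 : 0 <= u by rewrite divr_ge0 ?mulr_ge0.
have wu : w <= expR (- u).
  by rewrite ler_expR lerN2 ler_wpM2r ?invr_ge0 ?ler0n // -natrM ler_nat.
have zu : z <= u / D%:R.
  rewrite /z /u mulrAC [D%:R * _]mulrC mulfK ?gt_eqF // ler_wpM2r ?invr_ge0 ?ler0n //.
  by rewrite ler_nat.
rewrite ler_pdivlMr ?exprn_gt0 //; apply: le_trans (sqr_expRN_le u0).
have -> : w * z ^+ 2 * D%:R ^+ 2 = (z * D%:R) ^+ 2 * w by ring.
have zD0 : 0 <= z * D%:R by rewrite mulr_ge0 // ltW.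
rewrite ler_pM // ?exprn_ge0 //.
by rewrite lerXn2r ?nnegrE // -ler_pdivlMr.
Qed.

Lemma sum_incidences S (K : {set 'I_m}) (w : 'I_n -> R) :
  \sum_(j in K) \sum_(e in S j) w e =
  \sum_e w e * #|[set j in K | e \in S j]|%:R.
Proof.
rewrite (exchange_big_dep xpredT) //=; apply: eq_bigr => e _.
rewrite sumr_const [RHS]mulr_natr; congr (_ *+ _).
by apply: eq_card => j; rewrite inE.
Qed.

Lemma smooth_coverage_step S X X' (K : {set 'I_m}) :
  (forall j, X' j = X j + (j \in K))%N ->
  smooth_coverage S X + T%:R^-1 * \sum_(j in K) \sum_(e in S j) weight S X e
    - 4 / D%:R ^+ 2 * #|\bigcup_j S j|%:R <= smooth_coverage S X'.
Proof.
move=> X'E.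
rewrite sum_incidences.
have -> : 4 / D%:R ^+ 2 * #|\bigcup_j S j|%:R =
    \sum_e (if e \in \bigcup_j S j then 4 / D%:R ^+ 2 else 0) :> R.
  by rewrite -big_mkcond sumr_const mulr_natr.
rewrite mulr_sumr -big_split -sumrB /=; apply: ler_sum => e _.
have := weight_step S e X'E; set i := (if _ then _ else _); move: i => i.
by rewrite mulrA mulrAC [T%:R^-1 * _]mulrC; lra.
Qed.

(** For an optimal [O], an element covered [c] times, c >= 1, satisfies 1 <= (1 - w) + w c, where w
    is its weight; the claim is the sum over the elements. *)
Lemma marginal_weights S X k : (k <= m)%N ->
  exists2 O : {set 'I_m}, #|O| = k &
    (opt S k)%:R - smooth_coverage S X <= \sum_(j in O) \sum_(e in S j) weight S X e.
Proof.
move=> le_km; have [O cO <-] := opt_witness S le_km; exists O => //.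
rewrite lerBlDr /smooth_coverage.
rewrite sum_incidences.
rewrite -big_split /coverage -sum1_card big_mkcond natr_sum /=.
apply: ler_sum => e _; have w0 := weight_ge0 S X e; have w1 := weight_le1 S X e.
case: bigcupP => [[j jO ej]|_]; last by rewrite addr_ge0 ?mulr_ge0 ?subr_ge0.
have : (1 <= #|[set j in O | e \in S j]|)%N.
  by apply/card_gt0P; exists j; rewrite inE jO.
rewrite -(ler_nat R) => c1; have := ler_wpM2l w0 c1; lra.
Qed.

(** The directions [K t] need only be optimal up to [err]. Each step has length 1/T, so these
    defects cost [err] in total, while the second-order term is paid [T] times. *)
Lemma fractional_bound S k (X : nat -> 'I_m -> nat) (K : nat -> {set 'I_m}) (err : R) :
  (k <= m)%N -> 0 <= err ->
  (forall t j, (t < T)%N -> X t.+1 j = X t j + (j \in K t))%N ->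
  (forall t (O : {set 'I_m}), (t < T)%N -> #|O| = k ->
    \sum_(j in O) \sum_(e in S j) weight S (X t) e - err <=
    \sum_(j in K t) \sum_(e in S j) weight S (X t) e) ->
  (1 - (expR 1)^-1) * (opt S k)%:R - err
    - T%:R * (4 / D%:R ^+ 2 * #|\bigcup_j S j|%:R) <= smooth_coverage S (X T).
Proof.
move=> le_km err0 XS maxK; have Tr : 0 < T%:R :> R by rewrite ltr0n.
set c := 4 / D%:R ^+ 2 * _; have c0 : 0 <= c by rewrite mulr_ge0 ?divr_ge0 ?exprn_ge0.
have F0 : 0 <= smooth_coverage S (X 0%N).
  by apply: sumr_ge0 => e _; rewrite subr_ge0 weight_le1.
have := @contraction_bound R T (fun t => (opt S k)%:R - smooth_coverage S (X t))
  (T%:R^-1 * err + c) (opt S k)%:R T_gt0.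
rewrite mulrDr mulVKf ?gt_eqF // => main.
suff : (opt S k)%:R - smooth_coverage S (X T) <=
  (expR 1)^-1 * (opt S k)%:R + (err + T%:R * c) by lra.
apply: main => [|||t lt_tT]; rewrite ?ler0n ?gerBl //.
  by apply: addr_ge0 => //; rewrite mulr_ge0 // invr_ge0 ler0n.
have := smooth_coverage_step S (fun j => XS t j lt_tT); rewrite -/c.
have [O cO leO] := marginal_weights S (X t) le_km.
have := ler_wpM2l _ (maxK t O lt_tT cO) => /(_ T%:R^-1); rewrite invr_ge0 ler0n.
have := ler_wpM2l _ leO => /(_ T%:R^-1); rewrite invr_ge0 ler0n.
rewrite !mulrBr mulrBl mul1r => h1 h2 h3.
move: (h1 isT) (h2 isT) h3.
set F1 := smooth_coverage S (X t.+1); set F2 := smooth_coverage S (X t).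
move: (T%:R^-1 * \sum_(j in O) _) (T%:R^-1 * \sum_(j in K t) _) => a b.
lra.
Qed.

End Fractional.

(** * Random rounding *)

Section Independence.
Variable R : realType.

(** Independence in counting form: the set is a product of one factor per coordinate. *)
Lemma card_ffun_indep (I T : finType) (P : pred I) (B : I -> {set T}) (beta : R) :
  (forall i, P i -> #|B i|%:R <= beta * #|T|%:R) ->
  #|[set f : {ffun I -> T} | [forall i, P i ==> (f i \in B i)]]|%:R <=
    beta ^+ #|P| * #|{: {ffun I -> T}}|%:R.
Proof.
move=> leB; pose F i : pred T := if P i then [in B i] else predT.
have -> : #|[set f : {ffun I -> T} | [forall i, P i ==> (f i \in B i)]]| =
    (\prod_i #|F i|)%N.
  transitivity #|family F|; last by rewrite card_family foldrE big_image.
  apply: eq_card => f; rewrite inE; apply/forallP/familyP => h i.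
    by rewrite unfold_in /F; have := h i; case: (P i).
  by have := h i; rewrite unfold_in /F; case: (P i).
have -> : beta ^+ #|P| * #|{: {ffun I -> T}}|%:R =
    \prod_i ((if P i then beta else 1) * #|T|%:R).
  by rewrite big_split /= -big_mkcond !prodr_const card_ffun natrX.
rewrite natr_prod; apply: ler_prod => i _; rewrite ler0n /F /=.
by case: ifP => [/leB|_]; last by rewrite mul1r.
Qed.

Lemma card_tuple_indep (N : nat) (T : finType) (P : pred 'I_N) (B : {set T}) (beta : R) :
  #|B|%:R <= beta * #|T|%:R ->
  #|[set w : N.-tuple T | [forall i, P i ==> (tnth w i \in B)]]|%:R <=
    beta ^+ #|P| * #|{: N.-tuple T}|%:R.
Proof.
move=> leB; have := @card_ffun_indep 'I_N T P (fun=> B) beta (fun _ _ => leB).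
rewrite card_tuple card_ffun card_ord; apply: le_trans; rewrite ler_nat.
rewrite -(card_imset _ (can_inj (@finfun_of_tupleK T N))).
apply/subset_leq_card/subsetP => _ /imsetP[w wB ->].
rewrite inE; apply/forallP => i; rewrite ffunE.
by move: wB; rewrite inE => /forallP.
Qed.

(* Markov's inequality for the shortfall M - f. *)
Lemma card_below_mean (T : finType) (f : T -> nat) (M : nat) (tau gamma : R) :
  (0 < M)%N -> 0 <= tau -> (forall x, f x <= M)%N ->
  (tau + gamma) * M%:R * #|T|%:R <= (\sum_x f x)%N%:R ->
  #|[set x | (f x)%:R < tau * M%:R]|%:R <= (1 - gamma) * #|T|%:R.
Proof.
move=> M_gt0 tau0 f_le mean; have Mr : 0 < M%:R :> R by rewrite ltr0n.
set B := [set x | _].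
(* On [B] the value is below [tau * M]; elsewhere it is at most [M], hence at most
   [M * (tau + 1)]. *)
have : (\sum_x f x)%N%:R <= \sum_x (M%:R * (tau + 1 - (x \in B)%:R)) :> R.
  rewrite natr_sum; apply: ler_sum => x _; rewrite inE.
  case: ltP => h; last by rewrite subr0 mulrDr mulr1 ler_wpDl ?ler_nat ?mulr_ge0 // ltW.
  by rewrite addrK mulrC ltW.
rewrite -mulr_sumr big_split /= sumr_const sumrN.
have -> : \sum_x (x \in B)%:R = #|B|%:R :> R.
  rewrite -sum1_card natr_sum [RHS]big_mkcond /=.
  by apply: eq_bigr => x _; case: (x \in B).
move=> /(le_trans mean); rewrite -mulrA mulrCA ler_pM2l //.
by rewrite -[(tau + 1) *+ _]mulr_natr; lra.
Qed.

End Independence.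

Section Sampler.
Variables (m L : nat) (a : 'I_m -> nat).

Definition tickets : seq 'I_m := flatten [seq nseq (a j) j | j <- enum 'I_m].

(** A seed is read as a position in the list of tickets; seeds beyond its end yield [j0]. This can
    only add hits to a target set, which is why [sampler_ge] is an inequality. *)
Definition sampler (j0 : 'I_m) (c : L.-tuple bool) : 'I_m :=
  nth j0 tickets (enum_rank c).

Lemma sum_tickets (F : 'I_m -> nat) :
  (\sum_(j <- tickets) F j = \sum_j a j * F j)%N.
Proof.
rewrite big_flatten big_map big_enum /=; apply: eq_bigr => j _.
by rewrite big_nseq iter_addn_0 mulnC.
Qed.

Lemma size_tickets : size tickets = (\sum_j a j)%N.
Proof.
rewrite -sum1_size sum_tickets; apply: eq_bigr => j _; exact: muln1.
Qed.

Lemma sampler_ge j0 (A : {set 'I_m}) : (\sum_j a j <= 2 ^ L)%N ->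
  (\sum_(j in A) a j <= #|[set c | sampler j0 c \in A]|)%N.
Proof.
rewrite -size_tickets => le_s.
have cT : #|{: L.-tuple bool}| = (2 ^ L)%N by rewrite card_tuple card_bool.
have -> : (\sum_(j in A) a j = \sum_(j <- tickets) (j \in A))%N.
  rewrite sum_tickets big_mkcond; apply: eq_bigr => j _.
  by case: ifP; rewrite ?muln1 ?muln0.
rewrite -sum1_card [X in (_ <= X)%N]big_mkcond /= (big_nth j0).
rewrite (reindex (@enum_val _ {: L.-tuple bool})); last first.
  exact/onW_bij/enum_val_bij.
rewrite (eq_bigr (fun i : 'I_ _ => nat_of_bool (nth j0 tickets i \in A))); last first.
  by move=> i _ /=; rewrite inE /sampler enum_valK; case: (_ \in A).
rewrite -(big_mkord xpredT (fun i => nat_of_bool (nth j0 tickets i \in A))) cT.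
by rewrite [X in (_ <= X)%N](big_cat_nat (n := size tickets)) //= leq_addr.
Qed.

End Sampler.

Section Rounding.
Variables (R : realType) (m n k L q D T : nat) (S : 'I_m -> {set 'I_n}).
Variable X : 'I_m -> nat.

Local Notation seeds := {ffun 'I_m -> L.-tuple bool}.

Let ticket j := (q * (X j + D))%N.

Definition sampled (f : {ffun 'I_m -> L.-tuple bool}) : {set 'I_m} :=
  [set j | [exists i : 'I_m, (i < k)%N && (sampler ticket i (f i) == j)]].

Lemma card_sampled f : (k <= m)%N -> (#|sampled f| <= k)%N.
Proof.
move=> le_km; rewrite -[leqRHS](card_ltn_ord le_km).
apply: leq_trans (leq_imset_card (fun i => sampler ticket i (f i)) _).
apply/subset_leq_card/subsetP => j; rewrite inE => /existsP[i /andP[ik /eqP <-]].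
by apply: imset_f; rewrite inE.
Qed.

(** Convexity of the exponential between 0 and [- y], obtained by combining two instances of the
    tangent inequality at [b]. *)
Lemma expRN_scale (theta y : R) : 0 <= theta -> theta <= 1 ->
  expR (- (theta * y)) <= 1 - theta + theta * expR (- y).
Proof.
move=> th0 th1; set b := - (theta * y).
have tangent u : (1 + (u - b)) * expR b <= expR u.
  by rewrite -[u in leRHS](subrK b) expRD ler_wpM2r ?expR_ge0 ?expR_ge1Dx.
have th1' : 0 <= 1 - theta by rewrite subr_ge0.
have := ler_wpM2l th1' (tangent 0); rewrite expR0 mulr1 => h0.
have hy := ler_wpM2l th0 (tangent (- y)).
have -> : expR b = (1 - theta) * ((1 + (0 - b)) * expR b) +
    theta * ((1 + (- y - b)) * expR b) by rewrite /b; ring.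
exact: lerD.
Qed.

(** Element by element: with [p] the guaranteed chance that one draw hits [e], all [k] draws miss it
    with probability at most (1 - p)^k <= exp(-kp), and kp is at least [theta] times y_e. Then
    [expRN_scale] extracts the factor [theta]. *)
Lemma mean_sampled_coverage (theta : R) :
  (0 < T)%N -> (k <= m)%N -> 0 <= theta -> theta <= 1 ->
  theta * (2 ^ L)%:R <= (k * q * T)%:R ->
  (\sum_j ticket j <= 2 ^ L)%N ->
  theta * smooth_coverage R D T S X * #|{: {ffun 'I_m -> L.-tuple bool}}|%:R <=
    (\sum_f coverage S (sampled f))%N%:R.
Proof.
move=> T_gt0 le_km th0 th1 le_th le_tickets; 
have -> : (\sum_f coverage S (sampled f) =
    \sum_e #|[set f : seeds | e \in \bigcup_(j in sampled f) S j]|)%N.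
  transitivity (\sum_(f : seeds) \sum_e (e \in \bigcup_(j in sampled f) S j))%N.
    by apply: eq_bigr => f _; rewrite /coverage -sum1_card big_mkcond.
  rewrite exchange_big; apply: eq_bigr => e _; rewrite -sum1_card [RHS]big_mkcond /=.
  by apply: eq_bigr => f _; rewrite inE; case: (e \in _).
rewrite /smooth_coverage mulr_sumr mulr_suml natr_sum; apply: ler_sum => e _.
have Nr : 0 < (2 ^ L)%:R :> R by rewrite ltr0n expn_gt0.
set N : R := (2 ^ L)%:R in Nr le_th *.
have cT : #|{: L.-tuple bool}| = (2 ^ L)%N by rewrite card_tuple card_bool.
pose p : R := (q * load D S X e)%:R / N.
pose B (i : 'I_m) := [set c : L.-tuple bool | e \notin S (sampler ticket i c)].
have leB (i : 'I_m) : (i < k)%N -> #|B i|%:R <= (1 - p) * #|{: L.-tuple bool}|%:R.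
  move=> _; have := sampler_ge i [set j | e \in S j] le_tickets.
  rewrite (eq_bigl (fun j => e \in S j)) => [|j]; last by rewrite inE.
  rewrite -big_distrr /= -/(load D S X e) -(ler_nat R) => hit.
  rewrite cT -/N mulrBl mul1r divfK ?gt_eqF // lerBrDr.
  apply: le_trans (_ : _ <= #|B i|%:R + _) _; first by rewrite lerD2l; exact: hit.
  rewrite -natrD ler_nat -cT -(cardsC (B i)) leq_add2l.
  by apply/subset_leq_card/subsetP => c; rewrite !inE negbK.
have := card_ffun_indep leB; set miss := [set f | _] => card_miss.
have -> : #|[set f : seeds | e \in \bigcup_(j in sampled f) S j]| = (#|{: seeds}| - #|miss|)%N.
  rewrite -(cardsC miss) addKn; apply: eq_card => f; rewrite !inE negb_forall.
  apply/bigcupP/existsP => [[j]|[i]].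
    rewrite inE => /existsP[i /andP[ik /eqP <-]] ej; exists i.
    by rewrite negb_imply ik inE negbK.
  rewrite negb_imply inE negbK => /andP[ik ei]; exists (sampler ticket i (f i)) => //.
  by rewrite inE; apply/existsP; exists i; rewrite ik eqxx.
rewrite natrB ?max_card // -subr_ge0.
have ck : #|[pred i : 'I_m | (i < k)%N]| = k.
  by rewrite -[RHS](card_ltn_ord le_km); apply: eq_card => i; rewrite !inE.
rewrite ck in card_miss.
have p1 : 0 <= 1 - p.
  rewrite subr_ge0 /p ler_pdivrMr // mul1r ler_nat.
  apply: leq_trans le_tickets; rewrite /load big_distrr big_mkcond /=.
  by apply: leq_sum => j _; case: ifP.
have le_exp : (1 - p) ^+ k <= expR (- (theta * ((load D S X e)%:R / T%:R))).
  apply: (@le_trans _ _ (expR (- p) ^+ k)).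
    by rewrite lerXn2r ?nnegrE ?expR_ge0 //; exact: (expR_ge1Dx (- p)).
  rewrite -expRM_natl ler_expR mulrN lerN2.
  rewrite /p natrM mulrCA mulrA ler_pdivrMr ?ltr0n //.
  rewrite !mulrA -mulrAC -mulrA [_ * (load _ _ _ _)%:R]mulrC.
  by rewrite -mulrA ler_wpM2l ?ler0n // mulrA ler_pdivlMr // -!natrM.
have := expRN_scale ((load D S X e)%:R / T%:R) th0 th1; rewrite -/(weight R D T S X e) => le_w.
have := ler_wpM2r (ler0n R #|{: seeds}|) (le_trans le_exp le_w).
move: card_miss; set x := _ ^+ k; set y : R := #|{: seeds}|%:R; set z : R := #|miss|%:R.
by set w := weight _ _ _ _ _ _ => h1 h2; lra.
Qed.

End Rounding.

(** * The two protocols *)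

Section GreedyProtocol.
Variables (m n k : nat).
Hypotheses (k_gt0 : (0 < k)%N) (le_km : (k <= m)%N).

(** When all gains vanish, the selected set may already belong to [J]; hence the padding of the
    result. *)
Definition greedy : protocol m n :=
  @Protocol m n {set 'I_m} set0 n 0
    (fun t i J V c j => #|V j :\: \bigcup_(j' in J) V j'|)
    (fun t J sigma => topset 1 sigma :|: J)
    (pad k).

Lemma greedy_pooled S z t J j :
  @pooled m n greedy S z t J j = #|S j :\: \bigcup_(j' in J) S j'|.
Proof.
rewrite /pooled -(@sum_card_block m) ?(leq_trans k_gt0) //; apply: eq_bigr => i _ /=.
apply: eq_card => e; rewrite !in_setD in_setI in_setD ffunE in_setI.
case: (boolP (e \in block n i)) => ei; rewrite ?andbF // !andbT; congr (~~ _ && _).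
apply/bigcupP/bigcupP => -[j' j'J].
  by rewrite ffunE in_setI => /andP[ej' _]; exists j'.
by move=> ej'; exists j'; rewrite // ffunE in_setI ej'.
Qed.

Lemma greedy_bounded : bounded_sums greedy.
Proof.
move=> S z t J j; rewrite greedy_pooled /=.
by apply: leq_trans (max_card _) _; rewrite card_ord.
Qed.

Lemma greedy_result (R : realType) S z :
  let J := result (@run m n greedy S z k) in
  #|J| = k /\
  (1 - (expR 1)^-1) * (opt S k)%:R <= (coverage S J)%:R :> R.
Proof.
have m_gt0 : (0 < m)%N := leq_trans k_gt0 le_km.
pose J t := @run m n greedy S z t.
have JS t : exists2 j, J t.+1 = j |: J t &
    forall i, (#|S i :\: \bigcup_(i in J t) S i| <=
               #|S j :\: \bigcup_(i in J t) S i|)%N.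
  rewrite /J /=; set sigma := [ffun j => _].
  have sE j : sigma j = #|S j :\: \bigcup_(i in J t) S i|.
    by rewrite ffunE greedy_pooled.
  have /eqP/cards1P[j tj] := card_topset m_gt0 sigma.
  exists j; first by rewrite tj.
  move=> i; have := topset_max m_gt0 sigma (cards1 i).
  by rewrite tj !big_set1 !sE.
have cJ t : (#|J t| <= t)%N.
  elim: t => [|t IHt]; first by rewrite cards0.
  have [j -> _] := JS t; apply: leq_trans (leq_card_setU _ _) _.
  by rewrite cards1.
split => /=; first exact: card_pad.
apply: le_trans (greedy_bound le_km R k_gt0 JS) _.
by rewrite ler_nat coverage_mono // sub_pad.
Qed.

End GreedyProtocol.

Section RoundingProtocol.
Variables (R : realType) (m n k D T M q L : nat).
Hypotheses (k_gt0 : (0 < k)%N) (le_km : (k <= m)%N) (le_mn : (m <= n)%N).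
Hypotheses (D_gt0 : (0 < D)%N) (T_gt0 : (0 < T)%N) (M_gt0 : (0 < M)%N).
Implicit Types (S V : 'I_m -> {set 'I_n}) (X : 'I_m -> nat).

Let m_gt0 : (0 < m)%N. Proof. exact: leq_trans k_gt0 le_km. Qed.

(** Gains are sent as integers. Rounding down loses less than 1 per block, that is at most [m / M]
    for the unscaled gain of a set. *)
Definition scaled_gain V X (j : 'I_m) : nat :=
  Num.truncn (M%:R * \sum_(e in V j) weight R D T V X e).

Definition rounding_state : Type :=
  ({ffun 'I_m -> 'I_T.+1} * {set 'I_m} * {set 'I_m} * 'I_n.+1)%type.

Definition counts (X : {ffun 'I_m -> 'I_T.+1}) : {ffun 'I_m -> nat} :=
  [ffun j => nat_of_ord (X j)].

Definition rounding_summand (t : nat) (i : 'I_m) (s : rounding_state)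
    (V : {ffun 'I_m -> {set 'I_n}}) (c : L.-tuple bool) (j : 'I_m) : nat :=
  let: (X, cand, best, v) := s in
  if (t < T)%N then scaled_gain V (counts X) j
  else if odd (t - T) then coverage V cand
  else ((i < k)%N && (sampler (fun j => q * (counts X j + D))%N i c == j)).

(** In an evaluation step all coordinates of [sigma] carry the same number, the coverage of [cand],
    and the maximum reads it off. *)
Definition rounding_step (t : nat) (s : rounding_state)
    (sigma : {ffun 'I_m -> nat}) : rounding_state :=
  let: (X, cand, best, v) := s in
  if (t < T)%N then
    ([ffun j => inord (X j + (j \in topset k sigma))], cand, best, v)
  else if odd (t - T) then
    let x := (\max_j sigma j)%N in
    if (v < x)%N then (X, cand, cand, inord x) else s
  else (X, pad k [set j | 0 < sigma j]%N, best, v).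

Definition rounding_start : rounding_state :=
  ([ffun=> ord0], pad k set0, pad k set0, ord0).

(* The first T steps build a fractional solution X / T.  Afterwards the even
   steps sample a candidate from it and the odd ones evaluate the candidate. *)
Definition rounding : protocol m n :=
  @Protocol m n
    ({ffun 'I_m -> 'I_T.+1} * {set 'I_m} * {set 'I_m} * 'I_n.+1)%type
    rounding_start (M * n) L
    rounding_summand rounding_step (fun s => s.1.2).

Lemma weight_view S X i e : e \in block n i ->
  weight R D T (view S i) X e = weight R D T S X e.
Proof.
move=> ei; rewrite /weight; suff -> : load D (view S i) X e = load D S X e by [].
by apply: eq_bigl => j; rewrite ffunE inE ei andbT.
Qed.

Lemma sum_gain_view S X j :
  \sum_i \sum_(e in view S i j) weight R D T (view S i) X e =
  \sum_(e in S j) weight R D T S X e.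
Proof.
rewrite [RHS]big_mkcond -[RHS](@sum_block m) //=; apply: eq_bigr => i _.
rewrite -big_mkcondr /=; apply: eq_big => [e|e]; rewrite ffunE in_setI; first by rewrite andbC.
by move=> /andP[_ ei]; rewrite weight_view.
Qed.

Lemma sum_scaled_gain_le S X j :
  (\sum_i scaled_gain (view S i) X j)%N%:R <=
    M%:R * \sum_(e in S j) weight R D T S X e.
Proof.
rewrite -sum_gain_view mulr_sumr natr_sum; apply: ler_sum => i _.
by rewrite truncn_le mulr_ge0 // sumr_ge0 // => e _; apply: weight_ge0.
Qed.

Lemma sum_scaled_gain_ge S X j :
  M%:R * \sum_(e in S j) weight R D T S X e - m%:R <=
    (\sum_i scaled_gain (view S i) X j)%N%:R.
Proof.
rewrite -sum_gain_view mulr_sumr natr_sum lerBlDr.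
have -> : m%:R = \sum_(i < m) 1 :> R by rewrite sumr_const card_ord.
rewrite -big_split /=; apply: ler_sum => i _.
by rewrite natr1 ltW // truncnS_gt.
Qed.

Lemma rounding_bounded : bounded_sums rounding.
Proof.
have le_n : (n <= M * n)%N by rewrite leq_pmull.
move=> S z t [[[X cand] best] v] j; rewrite /pooled /=.
case: (t < T)%N => /=; last case: (odd (t - T)) => /=.
- rewrite -(ler_nat R); apply: le_trans (sum_scaled_gain_le _ _ _) _.
  rewrite natrM ler_wpM2l //; apply: (@le_trans _ _ (\sum_(e in S j) 1)).
    by apply: ler_sum => e _; apply: weight_le1.
  rewrite sumr_const ler_nat; apply: leq_trans (max_card _) _.
  by rewrite card_ord.
- rewrite sum_coverage_view //; apply: leq_trans le_n.
  by rewrite -[X in (_ <= X)%N]card_ord max_card.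
apply: leq_trans le_n; apply: leq_trans le_mn.
rewrite -[X in (_ <= X)%N]card_ord -sum1_card; apply: leq_sum => i _.
by case: (_ && _).
Qed.

Section Trajectory.
Variables (S : 'I_m -> {set 'I_n}) (z : nat -> 'I_m -> L.-tuple bool).

(** The numerators built by the first steps, without the bound imposed by the state type. They do
    not depend on the coins [z]. *)
Fixpoint fractional (t : nat) : {ffun 'I_m -> nat} :=
  if t is t'.+1 then [ffun j =>
    (fractional t' j + (j \in topset k
       [ffun j => \sum_i scaled_gain (view S i) (fractional t') j]))%N]
  else [ffun=> 0%N].

Definition candidate (t : nat) : {set 'I_m} :=
  pad k (sampled k q D (fractional T) [ffun i => z t i]).

Lemma fractional_le t j : (fractional t j <= t)%N.
Proof.
elim: t => [|t IHt]; rewrite /= ffunE // -addn1 leq_add //.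
by case: (j \in _).
Qed.

Lemma sum_fractional t : (\sum_j fractional t j = k * t)%N.
Proof.
elim: t => [|t IHt]; first by rewrite muln0 big1 // => j _; rewrite ffunE.
rewrite /=; under eq_bigr => j _ do rewrite ffunE.
rewrite big_split /= IHt mulnS addnC; congr addn.
set sigma := [ffun j => _]; rewrite -[RHS](card_topset le_km sigma) -sum1_card.
by rewrite [RHS]big_mkcond; apply: eq_bigr => j _; case: (j \in _).
Qed.

Definition encoded (t : nat) : {ffun 'I_m -> 'I_T.+1} :=
  [ffun j => inord (fractional t j)].

Lemma encodedK t : (t <= T)%N -> counts (encoded t) = fractional t.
Proof.
move=> le_tT; apply/ffunP => j; rewrite !ffunE inordK // ltnS.
exact: leq_trans (fractional_le t j) le_tT.
Qed.

Lemma run_fractional t : (t <= T)%N ->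
  @run m n rounding S z t = (encoded t, pad k set0, pad k set0, ord0).
Proof.
elim: t => [_|t IHt lt_tT] /=.
  congr (_, _, _, _); apply/ffunP => j; rewrite !ffunE.
  by apply: val_inj; rewrite /= inordK.
rewrite IHt ?(ltnW lt_tT) // /rounding_step lt_tT; congr (_, _, _, _).
apply/ffunP => j; rewrite [LHS]ffunE [RHS]ffunE; congr inord.
transitivity (fractional t j + (j \in topset k
    [ffun j => \sum_i scaled_gain (view S i) (fractional t) j]))%N; last first.
  by rewrite /= ffunE.
congr addn; first by rewrite -[in RHS](encodedK (ltnW lt_tT)) [RHS]ffunE.
congr (nat_of_bool (_ \in pred_of_set _)).
congr topset; congr fun_of_fin; apply/ffunP => j'; rewrite [LHS]ffunE [RHS]ffunE /pooled.
by apply: eq_bigr => i _ /=; rewrite lt_tT encodedK // ltnW.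
Qed.

(** Invariant of the sampling phase: the stored value [v] dominates every candidate evaluated so far
    and is attained or exceeded by [best]. *)
Lemma run_rounding r :
  exists cand best v,
    [/\ @run m n rounding S z (T + r.*2) = (encoded T, cand, best, v),
        #|best| = k, (v <= coverage S best)%N &
        forall r', (r' < r)%N ->
          (coverage S (candidate (T + r'.*2)) <= v)%N].
Proof.
elim: r => [|r [cand [best [v [runE cbest le_v seen]]]]].
  exists (pad k set0), (pad k set0), ord0; split=> //; last exact: card_pad.
  by rewrite addn0 run_fractional.
have ltT u : (T + u < T)%N = false by rewrite ltnNge leq_addr.
set w := candidate (T + r.*2).
have run1 : @run m n rounding S z (T + r.*2).+1 = (encoded T, w, best, v).
  rewrite /= runE /rounding_step ltT addKn odd_double.
  congr (_, pad _ _, _, _); apply/setP => j; rewrite !inE ffunE /pooled /=.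
  rewrite ltT addKn odd_double encodedK // lt0n sum_nat_eq0 negb_forall.
  by apply: eq_existsb => i; rewrite ffunE eqb0 negbK.
have -> : (T + r.+1.*2)%N = (T + r.*2).+2 by rewrite doubleS !addnS.
have runS u : @run m n rounding S z u.+1 =
    rounding_step u (@run m n rounding S z u)
      [ffun j => @pooled m n rounding S z u (@run m n rounding S z u) j] by [].
rewrite runS run1; set sigma := [ffun j => _].
have sigmaE j : sigma j = coverage S w.
  rewrite ffunE /pooled /= -addnS ltT addKn /= odd_double /=.
  exact: sum_coverage_view.
have maxE : (\max_j sigma j = coverage S w)%N.
  apply/eqP; rewrite eqn_leq; apply/andP; split.
    by apply/bigmax_leqP => j _; rewrite sigmaE.
  by rewrite -(sigmaE (Ordinal m_gt0)) leq_bigmax.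
have cw : #|w| = k by apply: card_pad.
rewrite /rounding_step -addnS ltT addKn /= odd_double /= maxE.
case: ltnP => [lt_vw|le_wv].
  exists w, w, (inord (coverage S w)).
  have inE_w : (inord (coverage S w) : 'I_n.+1) = coverage S w :> nat.
    by rewrite inordK // ltnS -[X in (_ <= X)%N]card_ord max_card.
  split; rewrite ?inE_w // => r'; rewrite ltnS leq_eqVlt => /predU1P[->|/seen le_v'] //.
  by rewrite (leq_trans le_v') // ltnW.
exists w, best, v; split=> // r'.
by rewrite ltnS leq_eqVlt => /predU1P[->|/seen].
Qed.

End Trajectory.

(** The direction maximises the rounded gains, so it can fall behind any [k] sets by at most [m / M]
    per set; this gives the error [k * m / M]. *)
Lemma fractional_quality S :
  (1 - (expR 1)^-1) * (opt S k)%:R - (k * m)%:R / M%:R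
    - T%:R * (4 / D%:R ^+ 2 * #|\bigcup_j S j|%:R) <=
  smooth_coverage R D T S (fractional S T).
Proof.
have Mr : 0 < M%:R :> R by rewrite ltr0n.
apply: (@fractional_bound R m n D T D_gt0 T_gt0 S k (fractional S) (fun t => topset k
       [ffun j => \sum_i scaled_gain (view S i) (fractional S t) j]%N)).
- exact: le_km.
- by rewrite divr_ge0.
- by move=> t j _; rewrite /= ffunE.
move=> t O _ cO; set sigma := [ffun j => _].
have := topset_max le_km sigma cO; rewrite -(ler_nat R) !natr_sum => le_sigma.
rewrite -(ler_pM2l Mr) mulrBr mulrCA divff ?gt_eqF // mulr1 !mulr_sumr.
apply: (@le_trans _ _ (\sum_(j in O) (sigma j)%:R)).
  have -> : (k * m)%:R = \sum_(j in O) m%:R :> R.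
    by rewrite sumr_const cO mulnC natrM mulr_natr.
  rewrite -sumrB; apply: ler_sum => j _; rewrite ffunE.
  exact: sum_scaled_gain_ge.
apply: (le_trans le_sigma); apply: ler_sum => j _; rewrite ffunE.
exact: sum_scaled_gain_le.
Qed.

End RoundingProtocol.

(** To be read with x = 2^L, y = kT and u = mD. With s = 1/(8E), dropping the remainder of the
    division and the tickets of the starting point costs (1 - s)/(1 + s), which is at least 1 -
    2s. *)
Lemma rounded_ratio (R : realType) (E q x y u : R) :
  1 <= E -> 0 <= q -> 0 <= x -> 0 <= y -> 8 * E * u <= y ->
  8 * E * (y + u) <= x -> x <= y + u + q * (y + u) ->
  (1 - (4 * E)^-1) * x <= q * y.
Proof.
move=> E1 q0 x0 y0 hu hW qW; have E0 : 0 < E by lra.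
pose s : R := (8 * E)^-1.
have sE : s * (8 * E) = 1 by rewrite mulVf // mulf_neq0 ?gt_eqF.
have -> : (4 * E)^-1 = 2 * s by rewrite /s; field; rewrite gt_eqF.
have s0 : 0 < s by rewrite invr_gt0 mulr_gt0.
have {}hu : u <= s * y by have := ler_wpM2l (ltW s0) hu; rewrite mulrA sE mul1r.
have {}hW : y + u <= s * x by have := ler_wpM2l (ltW s0) hW; rewrite mulrA sE mul1r.
have : q * (y + u) <= q * (y + s * y) by rewrite ler_wpM2l // lerD2l.
have : 0 <= s * s * x by rewrite !mulr_ge0 // ltW.
move=> h1 h2.
have : (1 - 2 * s) * x * (1 + s) <= q * y * (1 + s) by lra.
by rewrite ler_pM2r //; lra.
Qed.

(** * Choice of the parameters and success probability *)

Section Success.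
Variables (R : realType) (m n k C E d : nat).
Hypotheses (k_gt0 : (0 < k)%N) (le_km : (k <= m)%N) (le_mn : (m <= n)%N).
Hypotheses (C_gt0 : (0 < C)%N) (E_gt1 : (1 < E)%N) (le_mkC : (m <= k * C)%N).

Let T := (2048 * C ^ 3 * E ^ 3)%N.
Let D := (256 * C ^ 2 * E ^ 2)%N.
Let M := (8 * (k * m) * E)%N.
Let W := (k * T + m * D)%N.
Let L := up_log 2 (8 * E * W).
Let q := (2 ^ L %/ W)%N.

Definition repetitions := (2 * E * d * up_log 2 m)%N.

Definition covering_protocol : protocol m n := @rounding R m n k D T M q L.

Definition covering_steps := (T + repetitions.*2)%N.

Let m_gt0 : (0 < m)%N. Proof. exact: leq_trans k_gt0 le_km. Qed.
Let E_gt0 : (0 < E)%N. Proof. exact: ltnW. Qed.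
Let T_gt0 : (0 < T)%N. Proof. by rewrite /T 2!muln_gt0 !expn_gt0 C_gt0 E_gt0. Qed.
Let D_gt0 : (0 < D)%N. Proof. by rewrite /D 2!muln_gt0 !expn_gt0 C_gt0 E_gt0. Qed.
Let M_gt0 : (0 < M)%N. Proof. by rewrite /M !muln_gt0 k_gt0 m_gt0 E_gt0. Qed.
Let W_gt0 : (0 < W)%N. Proof. by rewrite /W addn_gt0 muln_gt0 k_gt0 T_gt0. Qed.

Lemma covering_bounded : bounded_sums covering_protocol.
Proof. exact: rounding_bounded. Qed.

Lemma mean_scale :
  (1 - (4 * E%:R)^-1) * (2 ^ L)%:R <= (k * q * T)%:R :> R.
Proof.
have mD : (8 * E * (m * D) <= k * T)%N.
  have -> : (k * T = 8 * E * (k * C * D))%N by rewrite /T /D; lia.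
  by rewrite leq_mul2l leq_mul2r le_mkC !orbT.
have qW : (2 ^ L <= W + q * W)%N.
  by rewrite [in leqLHS](divn_eq (2 ^ L) W) addnC leq_add2r ltnW // ltn_pmod.
have le_W : (8 * E * W <= 2 ^ L)%N by exact: up_logP.
have -> : (k * q * T = q * (k * T))%N by rewrite mulnAC mulnC.
rewrite natrM; apply: (@rounded_ratio _ _ _ _ _ (m * D)%:R); rewrite ?ler1n //.
- by rewrite -!natrM ler_nat.
- by rewrite -natrD -!natrM ler_nat.
by rewrite -natrD -natrM -natrD ler_nat.
Qed.

Section Instance.
Variable S : 'I_m -> {set 'I_n}.

Let X := fractional R k D T M S T.
Let tau : R := 1 - (expR 1)^-1 - E%:R^-1.

(** Each error term is at most Opt/(8E): the one from rounding the gains because Opt >= 1, the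
    second-order one because [opt_ge_fraction] and m <= kC bound the number of covered elements by C
    Opt. *)
Lemma fractional_optimality : (0 < opt S k)%N ->
  (1 - (expR 1)^-1 - (4 * E%:R)^-1) * (opt S k)%:R <= smooth_coverage R D T S X.
Proof.
move=> opt_gt0.
have := @fractional_quality R m n k D T M k_gt0 le_km D_gt0 T_gt0 M_gt0 S.
apply: le_trans; rewrite -/X mulrBl -addrA lerD2l -opprD lerN2.
have [Er Cr kr mr] : [/\ 0 < E%:R :> R, 0 < C%:R :> R, 0 < k%:R :> R & 0 < m%:R :> R].
  by rewrite !ltr0n.
have -> : (k * m)%:R / M%:R = (8 * E%:R)^-1 :> R.
  by rewrite /M !natrM; field; rewrite !gt_eqF.
have -> : T%:R * (4 / D%:R ^+ 2 * #|\bigcup_j S j|%:R) =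
    (8 * E%:R)^-1 * (#|\bigcup_j S j|%:R / C%:R) :> R.
  by rewrite /T /D !(natrX, natrM); field; rewrite !gt_eqF.
have : #|\bigcup_j S j|%:R / C%:R <= (opt S k)%:R :> R.
  rewrite ler_pdivrMr // -natrM ler_nat -(leq_pmul2l k_gt0).
  apply: leq_trans (opt_ge_fraction S le_km) _.
  by rewrite [leqLHS]mulnC [leqRHS]mulnCA leq_mul2l le_mkC orbT.
have : 1 <= (opt S k)%:R :> R by rewrite ler1n.
have -> : (4 * E%:R)^-1 = 2 * (8 * E%:R)^-1 :> R by field; rewrite gt_eqF.
set u : R := (opt S k)%:R; set v : R := _ / C%:R; set s : R := (8 * _)^-1 => u1 vu.
have s0 : 0 <= s by rewrite invr_ge0 mulr_ge0.
by have := ler_wpM2l s0 vu; have := ler_wpM2l s0 u1; lra.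
Qed.

Definition failing_seeds : {set {ffun 'I_m -> L.-tuple bool}} :=
  [set f | (coverage S (pad k (sampled k q D X f)))%:R < tau * (opt S k)%:R].

(** The mean is at least (1 - 1/(4E))(1 - 1/e - 1/(4E)) Opt, which is at least ([tau] + 1/(2E)) Opt;
    Markov's inequality applies with gap 1/(2E). *)
Lemma card_failing_seeds :
  #|failing_seeds|%:R <=
    (1 - (2 * E%:R)^-1) * #|{: {ffun 'I_m -> L.-tuple bool}}|%:R :> R.
Proof.
have Er : 0 < E%:R :> R by rewrite ltr0n.
have E2 : 2 <= E%:R :> R by rewrite ler_nat.
(* Both 1/e and 1/E are at most 1/2, so [tau] is nonnegative. *)
have e2 : 2 <= expR 1 :> R by exact: (expR_ge1Dx 1).
have Ei : E%:R^-1 <= 2^-1 :> R by rewrite lef_pV2 ?posrE.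
have ei : (expR 1)^-1 <= 2^-1 :> R by rewrite lef_pV2 ?posrE // expR_gt0.
have ei0 : 0 < (expR 1)^-1 :> R by rewrite invr_gt0 expR_gt0.
have half : (2 * E%:R)^-1 = 2^-1 * E%:R^-1 :> R by rewrite invfM.
have quarter : (4 * E%:R)^-1 = 4^-1 * E%:R^-1 :> R by rewrite invfM.
have Ei0 : 0 < E%:R^-1 :> R by rewrite invr_gt0.
have [opt0|opt_gt0] := posnP (opt S k).
  rewrite (_ : failing_seeds = set0) ?cards0 ?mulr_ge0 //; first by rewrite half; lra.
  by apply/setP => f; rewrite !inE opt0 mulr0 ltrn0.
apply: (card_below_mean opt_gt0); first by rewrite /tau; lra.
  by move=> f; apply: coverage_le_opt; apply: card_pad.
have opt_r : 0 < (opt S k)%:R :> R by rewrite ltr0n.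
have th0 : 0 <= 1 - (4 * E%:R)^-1 :> R by rewrite quarter; lra.
have th1 : 1 - (4 * E%:R)^-1 <= 1 :> R by rewrite quarter; lra.
have le_tickets : (\sum_j q * (X j + D) <= 2 ^ L)%N.
  rewrite -big_distrr big_split /= sum_fractional // sum_nat_const card_ord.
  exact: leq_trunc_div.
have := mean_sampled_coverage S T_gt0 le_km th0 th1 mean_scale le_tickets.
move=> mean.
have le_pad : (\sum_(f : {ffun 'I_m -> L.-tuple bool}) coverage S (sampled k q D X f) <=
    \sum_(f : {ffun 'I_m -> L.-tuple bool}) coverage S (pad k (sampled k q D X f)))%N.
  by apply: leq_sum => f _; apply/coverage_mono/sub_pad/card_sampled.
rewrite -(ler_nat R) in le_pad; apply: le_trans (le_trans mean le_pad).
rewrite ler_wpM2r //; have := ler_wpM2l th0 (fractional_optimality opt_gt0).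
apply: le_trans; rewrite mulrA ler_pM2r // /tau half quarter.
by nra.
Qed.

(** The factor 2E in [repetitions] cancels in the exponent, leaving exp(-d [up_log 2 m]), and e >=
    2. *)
Lemma failure_decay : (1 - (2 * E%:R)^-1) ^+ repetitions <= (m%:R ^+ d)^-1 :> R.
Proof.
have Er : 0 < E%:R :> R by rewrite ltr0n.
have E2 : 1 <= 2 * E%:R :> R by rewrite -natrM ler1n muln_gt0.
have e2 : 2 <= expR 1 :> R by exact: (expR_ge1Dx 1).
apply: (@le_trans _ _ (expR (- (2 * E%:R)^-1) ^+ repetitions)).
  rewrite lerXn2r ?nnegrE ?expR_ge0 ?subr_ge0 ?invf_le1 ?mulr_gt0 //.
  exact: (expR_ge1Dx (- _)).
rewrite -expRM_natr mulNr /repetitions -!mulnA mulnA 2!natrM mulKf; last first.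
  by rewrite mulf_neq0 ?gt_eqF.
rewrite expRN lef_pV2 ?posrE ?expR_gt0 ?exprn_gt0 ?ltr0n //.
rewrite -[(d * _)%:R]mulr1 expRM_natl mulnC exprM.
rewrite lerXn2r ?nnegrE ?exprn_ge0 ?expR_ge0 //.
apply: (@le_trans _ _ (2 ^+ up_log 2 m)).
  by rewrite -natrX ler_nat up_logP.
by rewrite lerXn2r ?nnegrE ?expR_ge0.
Qed.

(** The run fails only if every sampling step draws failing seeds. These steps use the coins of
    distinct rounds, and the failing set is the same for all of them because [X] is
    deterministic. *)
Lemma covering_success :
  1 - (m%:R ^+ d)^-1 <=
  prob R (fun w : coins (compile covering_protocol covering_steps) =>
    good_cover S k (E%:R^-1 : R) (output S w)).
Proof.
set A := compile _ _; rewrite /prob; set good := (X in #|X|).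
have round_lt (r : 'I_repetitions) : ((T + r.*2).*2.+1 < covering_steps.*2.+1)%N.
  by rewrite ltnS ltn_double ltn_add2l ltn_double.
pose sampling := [set Ordinal (round_lt r) | r : 'I_repetitions].
have card_sampling : #|sampling| = repetitions.
  rewrite card_imset ?card_ord // => r r' /(congr1 val) /= [].
  by move/double_inj/addnI/double_inj/val_inj.
have Er : 0 < E%:R :> R by rewrite ltr0n.
have fail := @card_tuple_indep R _ _ [in sampling] _ _ card_failing_seeds.
move: fail; set bad := [set w | _] => fail.
have bad_good (w : coins A) : w \notin bad -> good w.
  rewrite inE negb_forall => /existsP[i]; rewrite negb_imply => /andP[/imsetP[r _ ->] ok].
  have zE : [ffun j => @seed m n covering_protocol covering_steps w (T + r.*2) j] =
      tnth w (Ordinal (round_lt r)).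
    by apply/ffunP => j; rewrite ffunE /seed /coin (tnth_nth [ffun => nseq_tuple _ false]).
  rewrite /good /= compile_output; last exact: covering_bounded.
  have [cand [best [v [runE cbest le_v seen]]]] := @run_rounding R m n k D T M q L
    k_gt0 le_km S (@seed m n covering_protocol covering_steps w) repetitions.
  rewrite /covering_steps runE /= /good_cover cbest eqxx /=.
  move: ok; rewrite inE -leNgt => /le_trans; apply.
  rewrite ler_nat; apply: leq_trans le_v; apply: leq_trans (seen r (ltn_ord r)).
  by rewrite /candidate zE.
have coins_gt0 : 0 < #|coins A|%:R :> R.
  by rewrite ltr0n; apply/card_gt0P; exists [tuple [ffun=> [tuple false | i < L]] | i < _].
rewrite ler_pdivlMr // mulrBl mul1r lerBlDr.
have le_good : (#|coins A| <= #|good| + #|bad|)%N.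
  rewrite addnC -(cardsC bad) leq_add2l; apply/subset_leq_card/subsetP => w.
  by rewrite inE => /bad_good.
rewrite -(ler_nat R) natrD in le_good; apply: (le_trans le_good); rewrite lerD2l.
apply: le_trans fail _; rewrite ler_wpM2r //.
have -> : #|[in sampling]| = repetitions by rewrite -[RHS]card_sampling; apply: eq_card.
exact: failure_decay.
Qed.

End Instance.
End Success.

(** * Space and round bounds *)

Section Width.

Lemma width_pair (A B : finType) : (width (A * B)%type <= width A + width B)%N.
Proof. by rewrite up_log_min // card_prod expnD leq_mul ?up_logP. Qed.

Lemma width_set (A : finType) : width {set A} = #|A|.
Proof. by rewrite /width -cardsT -powersetT card_powerset cardsT up_expnK. Qed.

Lemma width_ffun (A B : finType) : (width {ffun A -> B} <= #|A| * width B)%N.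
Proof.
rewrite up_log_min // card_ffun mulnC expnM.
by case: #|A| => // a; rewrite leq_exp2r // up_logP.
Qed.

Lemma width_ord (x l : nat) : (x <= 2 ^ l)%N -> (width 'I_x <= l)%N.
Proof. by move=> le_x; rewrite up_log_min // card_ord. Qed.

(** A machine stores at most 2n bits for its block of all the sets, n(l + 2) + l for the shared
    state and l for the register, in total at most n(4 + 3l). *)
Lemma compile_linear_space (R : realType) (m n N l : nat) (P : protocol m n)
    (S : 'I_m -> {set 'I_n}) (B : R) :
  (0 < m)%N -> (m <= n)%N -> (seedlen P <= l)%N -> (maxsum P < 2 ^ l)%N ->
  (width (shared P) <= n * (l + 2) + l)%N -> (n * (4 + 3 * l))%N%:R <= B ->
  within_space (compile P N) S B.
Proof.
move=> m_gt0 le_mn le_seed le_sum le_shared le_B.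
have n_gt0 : (0 < n)%N := leq_trans m_gt0 le_mn.
have le_nl : (l <= n * l)%N by rewrite leq_pmull.
have fits x : (x <= n * (4 + 3 * l))%N -> x%:R <= B.
  by move=> le_x; apply: le_trans le_B; rewrite ler_nat.
have block_le : (m * blocksize m n <= 2 * n)%N.
  by rewrite /blocksize mulnS mulSn mul1n leq_add // mulnC leq_trunc_div.
have width_sum := width_ord le_sum.
apply: compile_within_space; apply: fits; try nia.
rewrite /machine_state; apply: leq_trans (width_pair _ _) _.
apply: leq_trans (leq_add (width_pair _ _) width_sum) _.
rewrite width_set card_prod !card_ord.
by nia.
Qed.

End Width.

Section Logarithms.
Variable R : realType.

Lemma ln2_ge_half : 2^-1 <= ln 2 :> R.
Proof.
rewrite -[leLHS]expRK ler_ln ?posrE ?expR_gt0 //.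
have : 2^-1 <= expR (- 2^-1) :> R by apply: le_trans (expR_ge1Dx _); lra.
by rewrite expRN lef_pV2 ?posrE ?expR_gt0.
Qed.

Lemma up_log_le_ln (x : nat) : (0 < x)%N -> (up_log 2 x)%:R <= 1 + 2 * ln x%:R :> R.
Proof.
move=> x_gt0; have lnx : 0 <= ln x%:R :> R by rewrite ln_ge0 // ler1n.
have [x_gt1|] := ltnP 1 x; last first.
  by move=> x_le1; rewrite (eqP (_ : up_log 2 x == 0)%N) ?up_log_eq0 ?x_le1 //; lra.
have := ltnW (up_log_gtn (isT : 1 < 2)%N x_gt1).
case: (up_log 2 x) => [|y] /=; first by move=> _; lra.
rewrite -(ler_nat R) natrX => le_yx.
have : ln (2 ^+ y) <= ln x%:R :> R by rewrite ler_ln ?posrE ?exprn_gt0 ?ltr0n.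
rewrite lnXn // -[ln 2 *+ y]mulr_natr -[y.+1%:R]natr1 => le_ln.
have : 0 <= (ln 2 - 2^-1) * y%:R :> R by rewrite mulr_ge0 // subr_ge0 ln2_ge_half.
by lra.
Qed.

End Logarithms.

(** With E <= m <= n all parameters are polynomial in [n], so seeds and counters fit in [l] bits;
    the power n^5 comes from 8EW, where [E] and [m] are at most n and [T] is O(n^3). *)
Lemma covering_within_space (R : realType) (m n k C E l N : nat) (B : R)
    (S : 'I_m -> {set 'I_n}) :
  (0 < k)%N -> (k <= m)%N -> (m <= n)%N -> (0 < C)%N -> (0 < E)%N -> (E <= m)%N ->
  (16 * (2048 * C ^ 3) * n ^ 5 <= 2 ^ l)%N ->
  (n * (4 + 3 * l))%N%:R <= B ->
  within_space (compile (covering_protocol R m n k C E) N) S B.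
Proof.
move=> k_gt0 le_km le_mn C_gt0 E_gt0 le_Em le_l.
have m_gt0 : (0 < m)%N := leq_trans k_gt0 le_km.
have n_gt0 : (0 < n)%N := leq_trans m_gt0 le_mn.
have le_En := leq_trans le_Em le_mn; have le_kn := leq_trans le_km le_mn.
have G_gt0 : (0 < 2048 * C ^ 3)%N by rewrite muln_gt0 expn_gt0 C_gt0.
have le_D : (256 * C ^ 2 * E ^ 2 <= 2048 * C ^ 3 * n ^ 3)%N.
  apply: leq_mul; first by rewrite leq_mul // leq_pexp2l.
  by apply: (@leq_trans (n ^ 2)); rewrite ?leq_exp2r ?leq_pexp2l.
have le_T : (2048 * C ^ 3 * E ^ 3 <= 2048 * C ^ 3 * n ^ 3)%N.
  by rewrite leq_mul2l leq_exp2r ?le_En ?orbT.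
have n5 : (n ^ 5 = n * n * n ^ 3)%N by rewrite !expnS expn0; lia.
have n3 : (n <= n ^ 3)%N by rewrite -[leqLHS]expn1 leq_pexp2l.
have n5_ge : (n ^ 3 <= n ^ 5)%N by rewrite leq_pexp2l.
have G5 G : (G * n ^ 3 <= G * n ^ 5)%N by rewrite leq_mul2l n5_ge orbT.
have G3 G : (0 < G)%N -> (n ^ 3 <= G * n ^ 3)%N by move=> ?; rewrite leq_pmull.
have n3_gt0 : (0 < n ^ 3)%N by rewrite expn_gt0 n_gt0.
apply: compile_linear_space => //=;
  move: (2048 * C ^ 3)%N (256 * _ * _)%N G_gt0 le_l le_D le_T => G D G_gt0 le_l le_D le_T;
  have {}G3 := G3 G G_gt0; have {}G5 := G5 G.
- apply: up_log_min => //; apply: leq_trans le_l.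
  have -> : (16 * G * n ^ 5 = 8 * n * (n * (G * n ^ 3) + n * (G * n ^ 3)))%N.
    by rewrite n5; lia.
  by apply: leq_mul; rewrite ?leq_mul2l //; apply: leq_add; apply: leq_mul.
- apply: leq_trans le_l; apply: (@leq_ltn_trans (8 * (n * n) * n * n)).
    by do 4! [apply: leq_mul => //].
  have -> : (8 * (n * n) * n * n = 8 * n ^ 4)%N by rewrite !expnS expn0; lia.
  have n4 : (n ^ 4 <= n ^ 5)%N by rewrite leq_pexp2l.
  have : (n ^ 5 <= G * n ^ 5)%N by rewrite leq_pmull.
  by lia.
have width_T : (width 'I_(G * E ^ 3).+1 <= l)%N by apply: width_ord; lia.
have width_n : (width 'I_n.+1 <= l)%N by apply: width_ord; lia.
apply: leq_trans (width_pair _ _) _; rewrite mulnDr.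
apply: leq_trans (leq_add (width_pair _ _) width_n) _; rewrite leq_add2r.
apply: leq_trans (leq_add (width_pair _ _) (leqnn _)) _.
apply: leq_trans (leq_add (leq_add (width_ffun _ _) (leqnn _)) (leqnn _)) _.
rewrite !width_set !card_ord.
apply: leq_trans (leq_add (leq_add (leq_mul le_mn width_T) le_mn) le_mn) _.
by lia.
Qed.

Lemma greedy_within_space (R : realType) (m n k l N : nat) (B : R)
    (S : 'I_m -> {set 'I_n}) :
  (0 < m)%N -> (m <= n)%N -> (n < 2 ^ l)%N -> (n * (4 + 3 * l))%N%:R <= B ->
  within_space (compile (greedy m n k) N) S B.
Proof.
move=> m_gt0 le_mn le_l; apply: compile_linear_space => //=.
by rewrite width_set card_ord; nia.
Qed.

Lemma soft_linear_ge (R : realType) (n G : nat) : (0 < n)%N -> (0 < G)%N ->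
  (n * (4 + 3 * up_log 2 (G * n ^ 5)))%N%:R <=
    soft_linear (30 + 6 * ln G%:R : R) 1 n.
Proof.
move=> n_gt0 G_gt0; rewrite /soft_linear expr1 natrM [_ * n%:R]mulrC -mulrA.
have lnn : 0 <= ln n%:R :> R by rewrite ln_ge0 // ler1n.
have lnG : 0 <= ln G%:R :> R by rewrite ln_ge0 // ler1n.
rewrite ler_wpM2l // natrD natrM.
have Gn_gt0 : (0 < G * n ^ 5)%N by rewrite muln_gt0 expn_gt0 n_gt0 G_gt0.
have := up_log_le_ln R Gn_gt0.
rewrite natrM natrX lnM ?posrE ?exprn_gt0 ?ltr0n // lnXn ?ltr0n //.
rewrite -[ln n%:R *+ 5]mulr_natr.
have : 0 <= ln G%:R * ln n%:R :> R by rewrite mulr_ge0.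
by lra.
Qed.

Lemma good_cover_weaken (R : realType) (m n k : nat) (S : 'I_m -> {set 'I_n})
    (eps eps' : R) J :
  eps <= eps' -> good_cover S k eps J -> good_cover S k eps' J.
Proof.
rewrite /good_cover => le_eps /andP[-> /=]; apply: le_trans.
by rewrite ler_wpM2r // lerD2l lerN2.
Qed.

Lemma prob_le (R : realType) (m : nat) (A : mpc m) (p q : pred (coins A)) :
  (forall w, p w -> q w) -> prob R p <= prob R q.
Proof.
move=> pq; rewrite /prob ler_wpM2r ?invr_ge0 // ler_nat.
exact/subset_leq_card/subsetP.
Qed.

Lemma covering_rounds (m C E d : nat) :
  ((covering_steps m C E d).*2.+1 =
   2 * (2048 * C ^ 3 * E ^ 3) + 8 * (d * E * up_log 2 m) + 1)%N.
Proof.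
rewrite /covering_steps /repetitions -!mul2n.
by move: (2048 * _ * _)%N => T; lia.
Qed.

(** * Arithmetic of the bound on the rounds *)

Section Rounds.
Variables (R : realType) (eps lm leps : R) (G d E : nat).
Hypotheses (eps_gt0 : 0 < eps) (eps_lt1 : eps < 1) (E_le : E%:R <= 2 * eps^-1).
Hypotheses (lm_ge : 2^-1 <= lm) (leps_ge0 : 0 <= leps).

Local Notation e3 := (eps ^- 3).
Local Notation Q := (4 * lm ^+ 2).

Let eps1 : 1 < eps^-1. Proof. by rewrite invf_gt1. Qed.

Let eps3 : eps^-1 <= e3.
Proof. by rewrite -exprVn -[leLHS]expr1 ler_weXn2l // ltW. Qed.

Let e3_ge1 : 1 <= e3. Proof. exact: ltW (lt_le_trans eps1 eps3). Qed.

Let e3_ge0 : 0 <= e3. Proof. exact: le_trans ler01 e3_ge1. Qed.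

Let Q_ge1 : 1 <= Q.
Proof.
by move: lm_ge (sqr_ge0 (lm - 2^-1)); rewrite !expr2; lra.
Qed.

Let Q_ge0 : 0 <= Q. Proof. exact: le_trans ler01 Q_ge1. Qed.

Let scale (x : R) : x <= (16 * G%:R + 32 * d%:R + 5) * e3 * Q ->
  x <= (64 * G%:R + 128 * d%:R + 20) * e3 * lm * (leps + lm).
Proof.
move/le_trans; apply; set u := _ * e3.
have -> : (64 * G%:R + 128 * d%:R + 20) * e3 = 4 * u by rewrite /u; ring.
have u0 : 0 <= u by rewrite mulr_ge0 // !addr_ge0 ?mulr_ge0.
have lm0 : 0 <= lm by move: lm_ge; lra.
have : 0 <= u * (lm * leps) by apply: mulr_ge0 => //; apply: mulr_ge0.
by rewrite expr2; lra.
Qed.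

Lemma covering_round_bound (u : nat) : u%:R <= 1 + 2 * lm ->
  (2 * (G * E ^ 3) + 8 * (d * E * u) + 1)%N%:R <=
    (64 * G%:R + 128 * d%:R + 20) * e3 * lm * (leps + lm).
Proof.
move=> u_le; apply: scale.
have log_m : u%:R <= 2 * Q.
  by move: lm_ge (sqr_ge0 (lm - 2^-1)); rewrite !expr2; lra.
have E3 : E%:R ^+ 3 <= 8 * e3.
  have -> : 8 * e3 = (2 * eps^-1) ^+ 3 by rewrite exprMn exprVn; ring.
  by rewrite lerXn2r ?nnegrE ?mulr_ge0 ?invr_ge0 // ltW.
rewrite !(natrD, natrX, natrM).
have h1 : G%:R * E%:R ^+ 3 <= G%:R * (8 * e3 * Q).
  by rewrite ler_wpM2l //; apply: (le_trans E3); rewrite ler_peMr // mulr_ge0.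
have h2 : d%:R * E%:R * u%:R <= d%:R * (2 * e3) * (2 * Q).
  have E_le3 : E%:R <= 2 * e3 by move: E_le eps3; lra.
  by rewrite ler_pM ?mulr_ge0 // ler_wpM2l.
have h3 : 1 <= e3 * Q by rewrite -[leLHS]mulr1 ler_pM.
by lra.
Qed.

Lemma greedy_round_bound (k : nat) : (k <= E)%N ->
  k.*2.+1%:R <= (64 * G%:R + 128 * d%:R + 20) * e3 * lm * (leps + lm).
Proof.
move=> le_kE; apply: scale.
have le_kEr : k%:R <= E%:R :> R by rewrite ler_nat.
have GQ : 0 <= G%:R * e3 * Q by apply: mulr_ge0 => //; apply: mulr_ge0.
have dQ : 0 <= d%:R * e3 * Q by apply: mulr_ge0 => //; apply: mulr_ge0.
have eQ : e3 <= e3 * Q by rewrite ler_peMr.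
move: E_le eps3 e3_ge1 => E_le' eps3' e3_ge1'.
by rewrite -natr1 -mul2n natrM; lra.
Qed.

End Rounds.

(* c is the constant hidden in k = Omega(m), d the exponent of the polynomial in
   "with high probability"; a, p are the constants hidden in the soft-O bound on
   memory and communication, b the one hidden in the bound on the rounds. *)
Theorem theorem1 (R : realType) (c : R) (hc : 0 < c) (d : nat) :
  exists (a : R) (p : nat) (b : R),
    forall (n m k : nat) (eps : R),
      (0 < m)%N -> (m <= n)%N -> (k <= m)%N -> c * m%:R <= k%:R ->
      0 < eps -> eps < 1 ->
      exists A : mpc m,
        (rounds A)%:R <= b * eps ^- 3 * ln m%:R * (ln eps^-1 + ln m%:R) /\
        forall S : 'I_m -> {set 'I_n},
          within_space A S (soft_linear a p n) /\
          1 - (m%:R ^+ d)^-1 <=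
            prob R (fun w : coins A => good_cover S k eps (output S w)).
Proof.
(* [C] exceeds 1/c, so that c m <= k gives m <= kC. *)
pose C := (Num.truncn c^-1).+1; pose G := (2048 * C ^ 3)%N.
exists (30 + 6 * ln (16 * G)%N%:R), 1%N, (64 * G%:R + 128 * d%:R + 20).
move=> n m k eps m_gt0 le_mn le_km le_ck eps_gt0 eps_lt1.
set B := soft_linear _ _ _.
have n_gt0 : (0 < n)%N := leq_trans m_gt0 le_mn.
have G_gt0 : (0 < G)%N by rewrite muln_gt0 expn_gt0.
pose l := up_log 2 (16 * G * n ^ 5).
have le_B : (n * (4 + 3 * l))%N%:R <= B by apply: soft_linear_ge; rewrite ?muln_gt0.
have k_gt0 : (0 < k)%N.
  by rewrite -(ltr0n R); apply: lt_le_trans le_ck; rewrite mulr_gt0 ?ltr0n.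
(* For m = 1 the round bound is 0 because ln 1 = 0, but so is the required probability: a machine
   that does nothing will do. *)
have [m_gt1|m_le1] := ltnP 1 m; last first.
  have m1 : m = 1%N by apply/eqP; rewrite eqn_leq m_le1.
  exists (@MPC m 0 0 (fun _ _ _ _ _ => [::]) (fun _ _ _ _ _ => [::]) (fun _ _ => true)).
  split=> [|S]; first by rewrite m1 ln1 mulr0 mul0r.
  have -> : (m%:R ^+ d)^-1 = 1 :> R by rewrite m1 expr1n invr1.
  split; last by rewrite subrr divr_ge0.
  have n_le : n%:R <= B by apply: le_trans le_B; rewrite ler_nat; nia.
  split=> [|w [|t] j _|//]; rewrite ?(le_trans _ n_le) //=.
  by rewrite /input size_map -cardE card_ord.
pose E := (Num.truncn eps^-1).+1.
have eps1 : 1 < eps^-1 by rewrite invf_gt1.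
have E_gt1 : (1 < E)%N by rewrite ltnS truncn_gt0 ltW.
have Er : 0 < E%:R :> R by rewrite ltr0n.
have epsE : E%:R^-1 <= eps.
  by rewrite -[eps]invrK lef_pV2 ?posrE ?invr_gt0 // ltW // truncnS_gt.
have E_le : E%:R <= 2 * eps^-1.
  have : (Num.truncn eps^-1)%:R <= eps^-1 by rewrite truncn_le invr_ge0 ltW.
  by rewrite /E -natr1; lra.
have lnm : 2^-1 <= ln m%:R :> R.
  by apply: le_trans (ln2_ge_half R) _; rewrite ler_ln ?posrE ?ltr0n // ler_nat.
have lneps : 0 <= ln eps^-1 by rewrite ln_ge0 // ltW.
(* If E > m, then k <= m < E, and the k deterministic greedy steps fit in the round budget. *)
have [le_Em|lt_mE] := leqP E m.
  have le_mkC : (m <= k * C)%N.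
    rewrite -(ler_nat R) natrM -(ler_pM2l hc); apply: (le_trans le_ck).
    rewrite mulrCA ler_peMr // -ler_pdivrMl // mulr1.
    by rewrite ltW // truncnS_gt.
  exists (compile (covering_protocol R m n k C E) (covering_steps m C E d)).
  split.
    rewrite [rounds _]/= covering_rounds; apply: covering_round_bound => //.
    exact: (up_log_le_ln R).
  move=> S; split; first exact: covering_within_space (up_logP _ _) le_B.
  apply: le_trans (@covering_success R m n k C E d k_gt0 le_km le_mn _ E_gt1 le_mkC S) _ => //.
  apply: prob_le => w; exact: good_cover_weaken.
exists (compile (greedy m n k) k); split.
  apply: (greedy_round_bound _ _ eps_gt0 eps_lt1 E_le lnm lneps).
  exact: leq_trans le_km (ltnW lt_mE).
move=> S; split.
  apply: greedy_within_space le_B => //.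
  apply: leq_trans (up_logP _ _) => //.
  have : (n <= n ^ 5)%N by rewrite -[leqLHS]expn1 leq_pexp2l.
  have : (n ^ 5 <= G * n ^ 5)%N by rewrite leq_pmull.
  by clearbody G; lia.
set A := compile _ _.
have -> : prob R (fun w : coins A => good_cover S k eps (output S w)) = 1.
  rewrite /prob (eq_card (B := predT)) ?divff // => [|w].
    by rewrite pnatr_eq0 -lt0n; apply/card_gt0P;
       exists [tuple [ffun=> [tuple false | i < 0]] | i < _].
  rewrite [RHS]inE unfold_in compile_output; last exact: greedy_bounded.
  have [cJ le_cov] := greedy_result k_gt0 le_km R S (@seed m n (greedy m n k) k w).
  rewrite /good_cover cJ eqxx /=; apply: le_trans le_cov.
  by rewrite ler_wpM2r // gerBl ltW.
by rewrite gerBl invr_ge0 exprn_ge0.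
Qed.
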